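(* Let $G$ be a group of order $60$ and let $J\in kG\otimes kG$ be a twist such that $A=(kG)^J$ is not cocommutative and is simple as a Hopf algebra. Then either (i) $G\cong\mathbb A_5$ and $A\cong(k\mathbb A_5)^{J_0}$, where $J_0$ is the twist lifted from $H_0=\langle(12)(34),(13)(24)\rangle\cong\mathbb Z_2\times\mathbb Z_2$ associated with a 2-cocycle on $\widehat{H_0}$ with nontrivial cohomology class; or (ii) $G\cong D_3\times D_5$ and $A\cong(k(D_3\times D_5))^{J_1}$, where $J_1$ is the twist lifted from a subgroup $H_1\cong\mathbb Z_2\times\mathbb Z_2$ of $D_3\times D_5$ associated with a 2-cocycle on $\widehat{H_1}$ with nontrivial cohomology class.
   Context: $k$ is an algebraically closed field of characteristic zero. $D_n$ denotes the dihedral group of order $2n$. For a twist $J$ in a Hopf algebra $A$, $A^J$ is the Hopf algebra with the same algebra and counit, comultiplication $\Delta^J(h)=J^{-1}\Delta(h)J$ and antipode $S^J(h)=v^{-1}S(h)v$, $v=m(S\otimes\mathrm{id})(J)$. For an abelian subgroup $H$ of a finite group $G$, $\widehat H$ is its character group and $e_\chi=\frac{1}{|H|}\sum_{h\in H}\chi(h^{-1})h$; the twist lifted from $H$ associated with a 2-cocycle $\omega$ on $\widehat H$ is $J=\sum_{\alpha,\beta\in\widehat H}\omega(\alpha,\beta)e_\alpha\otimes e_\beta\in kG\otimes kG$. A Hopf algebra is simple if it has no normal Hopf subalgebras (stable under ${}^hx=\sum h_1xS(h_2)$) other than $k$ and itself. *)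

(* Defs.v *)
From Stdlib Require List.
From HB Require Import structures.
From mathcomp Require Import all_boot all_order all_algebra all_fingroup all_solvable.
Set Implicit Arguments. Unset Strict Implicit. Unset Printing Implicit Defensive.
Import GRing.Theory.
Local Open Scope ring_scope.

(* Concrete model of the group algebra kG of a finite group (the whole
   finGroupType gT): elements are finitely supported functions gT -> k,
   i.e. x = \sum_g x(g) g.  kG (x) kG is identified with k[G x G], i.e.
   functions on gT * gT (with the direct-product group structure from
   gproduct.v), and kG (x) kG (x) kG with k[(G x G) x G]. *)

Section GroupAlgebra.
Variable k : fieldType.

Section OneGroup.
Variable gT : finGroupType.

Definition conv (x y : {ffun gT -> k}) : {ffun gT -> k} :=
  [ffun a => \sum_(g : gT) x g * y (g^-1 * a)%g].

Definition one : {ffun gT -> k} := [ffun a => (a == 1%g)%:R].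

Definition dlt (g : gT) : {ffun gT -> k} := [ffun a => (a == g)%:R].

Definition inv_of (x y : {ffun gT -> k}) : Prop := conv x y = one /\ conv y x = one.

End OneGroup.

Section Hopf.
Variable gT : finGroupType.

Definition tens (u v : {ffun gT -> k}) : {ffun (gT * gT)%type -> k} :=
  [ffun p => u p.1 * v p.2].

Definition comul (x : {ffun gT -> k}) : {ffun (gT * gT)%type -> k} :=
  [ffun p => if p.1 == p.2 then x p.1 else 0].

Definition counit (x : {ffun gT -> k}) : k := \sum_(g : gT) x g.

Definition antipode (x : {ffun gT -> k}) : {ffun gT -> k} := [ffun a => x a^-1%g].

Definition flip (t : {ffun (gT * gT)%type -> k}) : {ffun (gT * gT)%type -> k} :=
  [ffun p => t (p.2, p.1)].

Definition comulJ (J Jinv : {ffun (gT * gT)%type -> k}) (x : {ffun gT -> k}) :=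
  conv Jinv (conv (comul x) J).

(* twist equation (Delta (x) id)(J) (J (x) 1) = (id (x) Delta)(J) (1 (x) J) *)
Definition twist_eq (J : {ffun (gT * gT)%type -> k}) : Prop :=
  conv [ffun q : ((gT * gT) * gT)%type => if q.1.1 == q.1.2 then J (q.1.1, q.2) else 0]
       [ffun q : ((gT * gT) * gT)%type => J q.1 * (q.2 == 1%g)%:R]
  = conv [ffun q : ((gT * gT) * gT)%type => if q.1.2 == q.2 then J q.1 else 0]
         [ffun q : ((gT * gT) * gT)%type => (q.1.1 == 1%g)%:R * J (q.1.2, q.2)].

(* J is a twist: invertible, twist equation, (eps (x) id) J = 1 = (id (x) eps) J *)
Definition is_twist (J : {ffun (gT * gT)%type -> k}) : Prop :=
  (exists Jinv, inv_of J Jinv) /\ twist_eq J /\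
  (forall h : gT, \sum_(g : gT) J (g, h) = (h == 1%g)%:R) /\
  (forall g : gT, \sum_(h : gT) J (g, h) = (g == 1%g)%:R).

(* v = m (S (x) id)(J) *)
Definition vJ (J : {ffun (gT * gT)%type -> k}) : {ffun gT -> k} :=
  [ffun a => \sum_(g : gT) J (g, (g * a)%g)].

Definition antipJ (J : {ffun (gT * gT)%type -> k}) (vinv : {ffun gT -> k})
  (x : {ffun gT -> k}) : {ffun gT -> k} :=
  conv vinv (conv (antipode x) (vJ J)).

Definition cocomm (J : {ffun (gT * gT)%type -> k}) : Prop :=
  forall Jinv, inv_of J Jinv ->
  forall x : {ffun gT -> k}, flip (comulJ J Jinv x) = comulJ J Jinv x.

Definition in_tensor (B : {ffun gT -> k} -> Prop) (t : {ffun (gT * gT)%type -> k}) :=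
  exists s : seq ({ffun gT -> k} * {ffun gT -> k}),
    (forall p, List.In p s -> B p.1 /\ B p.2) /\
    t = [ffun q => \sum_(p <- s) tens p.1 p.2 q].

(* left adjoint action of (kG)^J:  ^h x = sum h_1 x S^J(h_2) *)
Definition adJ (J Jinv : {ffun (gT * gT)%type -> k}) (vinv : {ffun gT -> k})
  (h x : {ffun gT -> k}) : {ffun gT -> k} :=
  [ffun a => \sum_(p : gT * gT) comulJ J Jinv h p *
                 conv (conv (dlt p.1) x) (antipJ J vinv (dlt p.2)) a].

Definition normal_hopf_sub (J Jinv : {ffun (gT * gT)%type -> k}) (vinv : {ffun gT -> k})
  (B : {ffun gT -> k} -> Prop) : Prop :=
  B [ffun => 0] /\
  (forall (c : k) (x y : {ffun gT -> k}), B x -> B y -> B [ffun g => c * x g + y g]) /\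
  B (one gT) /\
  (forall x y, B x -> B y -> B (conv x y)) /\
  (forall x, B x -> in_tensor B (comulJ J Jinv x)) /\
  (forall x, B x -> B (antipJ J vinv x)) /\
  (forall h x, B x -> B (adJ J Jinv vinv h x)).

Definition hopf_simple (J : {ffun (gT * gT)%type -> k}) : Prop :=
  forall Jinv vinv, inv_of J Jinv -> inv_of (vJ J) vinv ->
  forall B, normal_hopf_sub J Jinv vinv B ->
    (forall x, B x <-> exists c : k, x = [ffun g => c * one gT g]) \/ (forall x, B x).

Definition is_char (H : {set gT}) (a : {ffun gT -> k}) : Prop :=
  a 1%g = 1 /\ (forall x y, x \in H -> y \in H -> a (x * y)%g = a x * a y) /\
  (forall x, x \notin H -> a x = 0).

Definition char_enum (H : {set gT}) (s : seq {ffun gT -> k}) : Prop :=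
  List.NoDup s /\ forall a, List.In a s <-> is_char H a.

Definition chmul (a b : {ffun gT -> k}) : {ffun gT -> k} := [ffun g => a g * b g].

Definition chtriv (H : {set gT}) : {ffun gT -> k} := [ffun g => (g \in H)%:R].

Definition idem (H : {set gT}) (a : {ffun gT -> k}) : {ffun gT -> k} :=
  [ffun g => if g \in H then a g^-1%g / #|H|%:R else 0].

Definition cocycle (H : {set gT}) (s : seq {ffun gT -> k})
  (om : {ffun gT -> k} -> {ffun gT -> k} -> k) : Prop :=
  (forall a b, List.In a s -> List.In b s -> om a b != 0) /\
  (forall a b c, List.In a s -> List.In b s -> List.In c s ->
     om a b * om (chmul a b) c = om b c * om a (chmul b c)) /\
  (forall a, List.In a s -> om (chtriv H) a = 1 /\ om a (chtriv H) = 1).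

Definition coboundary (s : seq {ffun gT -> k})
  (om : {ffun gT -> k} -> {ffun gT -> k} -> k) : Prop :=
  exists f : {ffun gT -> k} -> k,
    (forall a, List.In a s -> f a != 0) /\
    (forall a b, List.In a s -> List.In b s -> om a b = f a * f b / f (chmul a b)).

Definition lifted_twist_nontriv (H : {set gT}) (J : {ffun (gT * gT)%type -> k}) : Prop :=
  exists (s : seq {ffun gT -> k}) (om : {ffun gT -> k} -> {ffun gT -> k} -> k),
    char_enum H s /\ cocycle H s om /\ ~ coboundary s om /\
        J = [ffun p => \sum_(a <- s) \sum_(b <- s) om a b * (idem H a p.1 * idem H b p.2)].

End Hopf.

Section Iso.
Variables gT hT : finGroupType.

Definition tmap (f : {ffun gT -> k} -> {ffun hT -> k}) (t : {ffun (gT * gT)%type -> k})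
  : {ffun (hT * hT)%type -> k} :=
  [ffun q => \sum_(p : gT * gT) t p * (f (dlt p.1) q.1 * f (dlt p.2) q.2)].

Definition hopf_iso (J : {ffun (gT * gT)%type -> k}) (J' : {ffun (hT * hT)%type -> k})
  (f : {ffun gT -> k} -> {ffun hT -> k}) : Prop :=
  (forall (c : k) (x y : {ffun gT -> k}), f [ffun g => c * x g + y g] = [ffun g => c * f x g + f y g]) /\
  bijective f /\
  f (one gT) = one hT /\
  (forall x y, f (conv x y) = conv (f x) (f y)) /\
  (forall x, counit (f x) = counit x) /\
  (forall Jinv J'inv, inv_of J Jinv -> inv_of J' J'inv ->
     forall x, tmap f (comulJ J Jinv x) = comulJ J' J'inv (f x)).

Definition hopf_isomorphic (J : {ffun (gT * gT)%type -> k}) (J' : {ffun (hT * hT)%type -> k}) :=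
  exists f, hopf_iso J J' f.

End Iso.
End GroupAlgebra.

Definition A5T : finGroupType := [subg 'Alt_('I_5)%G].

(* (12)(34) and (13)(24), with points 1..5 encoded as 0..4 in 'I_5 *)
Definition perm_12_34 : {perm 'I_5} :=
  (tperm (@Ordinal 5 0 isT) (@Ordinal 5 1 isT) * tperm (@Ordinal 5 2 isT) (@Ordinal 5 3 isT))%g.
Definition perm_13_24 : {perm 'I_5} :=
  (tperm (@Ordinal 5 0 isT) (@Ordinal 5 2 isT) * tperm (@Ordinal 5 1 isT) (@Ordinal 5 3 isT))%g.

Definition H0 : {set A5T} :=
  <<[set subg 'Alt_('I_5)%G perm_12_34; subg 'Alt_('I_5)%G perm_13_24]>>%g.

(* D_3 x D_5 ; mathcomp's 'D_m is the dihedral group of ORDER m *)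
Definition D3xD5 : finGroupType := ('D_6 * 'D_10)%type.

(* Main.v *)
(* A twist J turns kG into a coalgebra with coproduct x |-> Delta(x) J, on which G
   acts by left translation; let B be the dual algebra.  A simple B-module gives a
   simple subcoalgebra D of dimension n^2.  Its translates gD are independent by the
   Chinese remainder theorem, and with H the stabilizer of D one has
   (kH (x) 1) Delta(D) J inside D (x) D; comparing dimensions yields |H| = n^2 and
   kG = sum of the gD.  As |G| = 60, H is abelian of order 1 or 4, every character of
   H occurs exactly once in D, so D = kH x with x invertible, and the gauge transform
   J0 = Delta(x) J (x^-1 (x) x^-1) lies in kH (x) kH.  Such a twist is lifted from H by
   a 2-cocycle on the dual group, and it is symmetric when the cocycle is a coboundary,
   in particular when H is cyclic.  Noncocommutativity therefore forces H to be a
   Klein four-group and the class to be nontrivial.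

   A central subgroup spans a normal Hopf subalgebra of (kG)^J, so simplicity gives
   Z(G) = 1.  If N(H) = C(H), Burnside's transfer theorem provides a normal complement
   of order 15 and G is D_3 x D_5; otherwise |N(H)| = 12 and G acts faithfully and by
   even permutations on the five cosets of N(H). *)
Require Import Defs.
From Stdlib Require Classical_Prop.
From HB Require Import structures.
From mathcomp Require Import all_boot all_order all_algebra all_fingroup all_solvable.
From mathcomp Require Import all_field all_character ring.
Set Implicit Arguments. Unset Strict Implicit. Unset Printing Implicit Defensive.

Local Open Scope group_scope.

(** * Burnside's normal complement theorem *)

(** In the dual basis the product of B is d_a d_b = sum_g J(g^-1 a, g^-1 b) d_g. The twist equation
    is its associativity, and the coefficients do not change when a, b and g are multiplied on the
    left by the same element; hence G acts on B by automorphisms and permutes the subcoalgebras gD.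
    That dim D is n^2 rests on the density theorem for irreducible matrix algebras, and so on k
    being algebraically closed. Two counts meet: invertibility of J gives |H| <= n^2, independence
    of the translates gives [G:H] n^2 <= |G|. Equality leaves no slack: H has n^2 characters, each
    has a nonzero component in D, so each component is a line. A gauge transform leaves the Hopf
    algebra unchanged up to isomorphism, conjugation by x being the isomorphism; this allows J to be
    replaced by a twist in kH (x) kH. The trivial H is excluded together with the cyclic groups of
    order 4. [hopf_simple] speaks only about inverses of J and of [vJ J]. It therefore yields
    nothing until v is known to be invertible, and an explicit inverse is computed from J^-1. *)

Section BurnsideComplement.
Import FiniteModule.
Variables (gT : finGroupType) (p : nat) (G P : {group gT}).
Hypotheses (sylP : p.-Sylow(G) P) (cNP : 'N_G(P) \subset 'C(P)).

Let sPG : P \subset G := pHall_sub sylP.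
Let abP : abelian P.
Proof. by apply: subset_trans cNP; rewrite subsetI sPG normG. Qed.

(* P and P :^ g^-1 are both Sylow subgroups of the centralizer of x. *)
Lemma abelian_sylow_fusion x g : x \in P -> g \in G -> x ^ g \in P -> x ^ g = x.
Proof.
move=> xP gG xgP.
have sPC : P \subset 'C_G[x].
  rewrite subsetI sPG; apply/subsetP=> y yP; apply/cent1P.
  exact: (centsP abP).
have sPgC : P :^ g^-1 \subset 'C_G[x].
  rewrite subsetI conj_subG ?groupV //; apply/subsetP=> _ /imsetP[y yP ->];
    apply/cent1P.
  rewrite -[X in commute _ X](conjgK g x) /commute -!conjMg; congr (_ ^ _).
  exact: (centsP abP).
have syl1 : p.-Sylow('C_G[x]) P by apply: pHall_subl sPC (subsetIl _ _) sylP.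
have syl2 : p.-Sylow('C_G[x]) (P :^ g^-1).
  apply: pHall_subl sPgC (subsetIl _ _) _.
  by rewrite pHallJ // groupV.
have [c] := Sylow_trans syl1 syl2.
rewrite inE => /andP[cG /cent1P cx] eP.
have ncg : c * g \in 'N_G(P).
  rewrite inE groupM //=; apply/normP.
  by rewrite conjsgM -eP -conjsgM mulVg conjsg1.
have := subsetP cNP _ ncg => /centP/(_ _ xP) cxx.
have xc : x ^ c = x by rewrite conjgE -cx mulKg.
by rewrite -[X in X ^ g]xc -conjgM conjgE -cxx mulKg.
Qed.

(** On P the transfer into P is x |-> x^|G:P|: each factor of its cycle expansion is a conjugate in
    P of a power of x in P, hence equal to that power. As |G:P| is prime to |P|, the kernel meets P
    trivially; as the values lie in a copy of P, the kernel is large enough to be a complement. *)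
Lemma Burnside_complement : exists K : {group gT}, K ><| P = G.
Proof.
(* The transfer is defined through a morphism with abelian image; here it is the identity of P. *)
have abA : abelian (idm P @* P) by rewrite morphim_idm.
have imP u : u \in P -> u \in idm P @* P by rewrite morphim_idm.
pose tau := transfer_morphism G abA.
have tauE x : x \in P -> tau x = fmod abA (x ^+ #|G : P|).
  move=> xP; have xG := subsetP sPG _ xP.
  have partG := rcosets_cycle_partition sPG xG.
  have trX := transversalP partG.
  rewrite /= (transfer_cycle_expansion sPG abA xG trX).
  rewrite -(sum_index_rcosets_cycle sPG xG trX).
  have mem y : y \in transversal (rcosets P G :* <[x]>) G ->
      (x ^+ #|<[x]> : P :* y|) ^ y^-1 = x ^+ #|<[x]> : P :* y|.
    move=> yX; have yG := subsetP (transversal_sub trX) _ yX.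
    apply: abelian_sylow_fusion; rewrite ?groupX ?groupV //.
    have := mulg_exp_card_rcosets P x y; rewrite mem_rcoset conjgE invgK.
    by rewrite -mulgA.
  rewrite (eq_bigr (fun y => fmod abA (x ^+ #|<[x]> : P :* y|))) => [|y yX];
    last by rewrite /= mem.
  elim/big_rec2: _ => [|y m z _ ->]; first by rewrite expg0 fmod1.
  by rewrite expgD fmodM //; apply/imP/groupX.
pose K := 'ker tau.
have nKG : K <| G := ker_normal tau.
have tiKP : K :&: P = 1.
  apply/trivgP/subsetP=> x /setIP[/kerP kx xP]; have xG := subsetP sPG _ xP.
  have := kx xG; rewrite tauE // => f0.
  have : fmod abA (x ^+ #|G : P|) = fmod abA 1 by rewrite f0 fmod1.
  move/(injmP (injm_fmod abA));
    move=> /(_ (imP _ (groupX _ xP)) (imP _ (group1 P)))/eqP.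
  rewrite -order_dvdn => d1; rewrite inE -order_eq1 -dvdn1.
  have cop : coprime #|P| #|G : P| by case/andP: (pHall_Hall sylP).
  rewrite -(eqP cop) dvdn_gcd d1 andbT; exact: order_dvdG.
exists [group of K]; rewrite sdprodE ?(subset_trans sPG (normal_norm nKG)) //.
apply/eqP; rewrite eqEcard mul_subG ?(normal_sub nKG) //=; rewrite TI_cardMg //.
rewrite -(Lagrange (normal_sub nKG)) leq_pmul2l ?cardG_gt0 //.
rewrite -card_quotient ?normal_norm // (card_isog (first_isog tau)).
apply: leq_trans (subset_leq_card (subsetT _)) _.
rewrite cardsT card_sub; apply/subset_leq_card/subsetP=> x; rewrite inE /=.
by rewrite morphim_idm.
Qed.
End BurnsideComplement.

(** * Groups of order 60 with a Klein four Sylow subgroup *)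

Section InvolutionAction.
Variables (gT : finGroupType) (x : gT).
Hypothesis prx : prime #[x].

(* x * x ^ u is fixed by u, so it is trivial or generates <[x]>. *)
Lemma involution_prime_cycle u : u ^+ 2 = 1 -> u \in 'N(<[x]>) -> x ^ u = x \/ x ^
  u = x^-1.
Proof.
move=> u2 nu; have xu : x ^ u \in <[x]> by rewrite memJ_norm ?cycle_id.
pose y := x * x ^ u.
have yx : y \in <[x]> by rewrite groupM ?cycle_id.
have yu : y ^ u = y.
  rewrite /y conjMg -conjgM -expg2 u2 conjg1.
  by apply: (centsP (cycle_abelian x)) => //; exact: cycle_id.
have [y1|ny] := eqVneq y 1; [right|left].
  by apply/eqP; rewrite eq_sym eq_invg_mul; apply/eqP.
have eyx : <[y]> = <[x]>.
  apply/eqP; rewrite eqEcard cycle_subG yx /= -/#[y] -/#[x].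
  have := order_dvdG yx; rewrite -/#[x] => /(prime_nt_dvdP prx) -> //.
  by rewrite order_eq1.
have /cycleP[i ->] : x \in <[y]> by rewrite eyx cycle_id.
by rewrite conjXg yu.
Qed.

(** An element of V that does not centralize x inverts it, and the product of two such elements
    centralizes it, so the centralizer of x has at most two cosets in V. *)
Lemma card_cent_elementary (V : {group gT}) : V \subset 'N(<[x]>) ->
  (forall u, u \in V -> u ^+ 2 = 1) -> #|V| <= 2 * #|'C_V[x]|.
Proof.
move=> nV V2; have [sVC|/subsetPn[u uV nu]] := boolP (V \subset 'C[x]).
  by rewrite (setIidPl sVC) leq_pmull.
have inv v : v \in V -> v \notin 'C[x] -> x ^ v = x^-1.
  move=> vV nv; have [xv|//] := involution_prime_cycle (V2 v vV) (subsetP nV v vV).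
  by case/negP: nv; apply/cent1P/commute_sym/commgP/conjg_fixP.
have sV : V \subset 'C_V[x] :|: 'C_V[x] :* u.
  apply/subsetP=> v vV; rewrite inE [v \in 'C_V[x]]inE vV /=.
  have [//|nv] := boolP (v \in 'C[x]); rewrite mem_rcoset inE groupM ?groupV //=.
  apply/cent1P/commute_sym/commgP/conjg_fixP; rewrite conjgM inv // conjVg.
  have -> : u^-1 = u by apply/eqP; rewrite eq_invg_mul -expg2 V2.
  by rewrite inv ?invgK.
apply: leq_trans (subset_leq_card sV) _; apply: leq_trans (leq_card_setU _ _) _.
by rewrite card_rcoset mul2n addnn.
Qed.
End InvolutionAction.

Lemma dihedral_isog (gT : finGroupType) (D : {group gT}) q x a : (1 < q)%N ->
  D = <[x]> <*> <[a]> :> {set gT} -> x ^+ q = 1 -> a ^+ 2 = 1 -> x ^ a = x^-1 ->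
  #|D| = q.*2 -> D \isog [set: 'D_q.*2].
Proof.
move=> q1 defD xq a2 xa oD; rewrite isogEcard card_dihedral // oD leqnn andbT.
rewrite Grp_dihedral //; apply/existsP; exists (x, a) => /=.
by rewrite !xpair_eqE defD xq a2 xa !eqxx.
Qed.

(** A unique Sylow p-subgroup is the p-core, hence characteristic; it is thus normal in every group
    in which K is normal. *)
Lemma pcore_order (gT : finGroupType) (K : {group gT}) p : prime p ->
  #|'Syl_p(K)| = 1%N -> logn p #|K| = 1%N -> exists x, [/\ #[x] = p, x \in K &
    <[x]> \char K].
Proof.
move=> pr_p /eqP/normal_sylowP[P sylP nPK] lK.
have oP : #|P| = p by rewrite (card_Hall sylP) p_part lK expn1.
have /cyclicP[x defP] : cyclic P by apply: prime_cyclic; rewrite oP.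
exists x; rewrite /order -cycle_subG -defP (normal_sub nPK); split=> //.
by rewrite -(normal_Hall_pcore sylP nPK) pcore_char.
Qed.

(** The only divisor of 15 congruent to 1 modulo 3 is 1, and likewise modulo 5. The two prime cycles
    are kept apart because the Klein group will act on each of them separately. *)
Lemma card15_cycles (gT : finGroupType) (K : {group gT}) : #|K| = 15 ->
  exists x y, [/\ #[x] = 3, #[y] = 5, <[x]> \char K, <[y]> \char K & <[x]> \x <[y]>
    = K].
Proof.
move=> oK.
have s3 : #|'Syl_3(K)| = 1%N.
  have := card_Syl_dvd 3 K; have := card_Syl_mod K (isT : prime 3); rewrite oK.
  move: #|_| => n n1 n15; have : n \in divisors 15 by rewrite -dvdn_divisors.
  by rewrite !inE => /or4P[] /eqP e; rewrite e in n1 *.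
have s5 : #|'Syl_5(K)| = 1%N.
  have := card_Syl_dvd 5 K; have := card_Syl_mod K (isT : prime 5); rewrite oK.
  move: #|_| => n n1 n15; have : n \in divisors 15 by rewrite -dvdn_divisors.
  by rewrite !inE => /or4P[] /eqP e; rewrite e in n1 *.
have l3 : logn 3 #|K| = 1%N by rewrite oK.
have l5 : logn 5 #|K| = 1%N by rewrite oK.
have [x [ox xK chx]] := pcore_order (isT : prime 3) s3 l3.
have [y [oy yK chy]] := pcore_order (isT : prime 5) s5 l5.
have tixy : <[x]> :&: <[y]> = 1 by apply: coprime_TIg; rewrite -/#[x] -/#[y] ox oy.
have cxy : <[y]> \subset 'C(<[x]>).
  apply/commG1P/trivgP; rewrite -tixy subsetI commg_subl commg_subr.
  apply/andP; split; [apply: subset_trans (char_norm chx)|apply: subset_trans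
    (char_norm chy)];
    by rewrite cycle_subG.
exists x, y; split=> //; rewrite dprodE //.
apply/eqP; rewrite eqEcard mul_subG ?cycle_subG //= TI_cardMg // oK.
by rewrite -/#[x] -/#[y] ox oy.
Qed.

Lemma dprod_isog_prod (gT aT bT : finGroupType) (G D1 D2 : {group gT}) :
  D1 \x D2 = G -> D1 \isog [set: aT] -> D2 \isog [set: bT] -> G \isog [set: (aT *
    bT)%type].
Proof.
move=> defG i1 i2; have defX : setX [set: aT] 1 \x setX 1 [set: bT] = [set: (aT *
  bT)%type].
  by rewrite setX_dprod; apply/setP=> p; rewrite !inE.
apply: (isog_dprod defG defX).
  exact: isog_trans i1 (isog_setX1 _ _).
exact: isog_trans i2 (isog_set1X _ _).
Qed.

Lemma dprod_D3xD5 (gT : finGroupType) (G D1 D2 : {group gT}) :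
  D1 \x D2 = G -> D1 \isog [set: 'D_6] -> D2 \isog [set: 'D_10] -> G \isog [set: D3xD5].
Proof. by move=> defG i1 i2; rewrite /D3xD5 /reverse_coercion;
  exact: dprod_isog_prod defG i1 i2. Qed.

(** V acts on K = C_3 x C_5. The centralizers of x and of y in V have order at least 2 and meet
    trivially, so both have order 2 and V is their product. The generator [a] centralizing y must
    invert x, the generator [b] centralizing x must invert y, and the two resulting dihedral groups
    commute. *)
Lemma klein_complement (gT : finGroupType) (G K V : {group gT}) :
  #|G| = 60 -> 'Z(G) = 1 -> K ><| V = G -> #|V| = 4 -> (forall u, u \in V -> u ^+ 2
    = 1) ->
  G \isog [set: D3xD5].
Proof.
move=> oG Z1 defG oV V2; have [nKG sVG defKV nKV tiKV] := sdprod_context defG.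
have oK : #|K| = 15.
  by apply/eqP; rewrite -(eqn_pmul2r (isT : 0 < 4)%N) -oV (sdprod_card defG) oG oV.
have [x [y [ox oy chx chy defK]]] := card15_cycles oK.
have [_ defKm cxy tixy] := dprodP defK.
have nVx : V \subset 'N(<[x]>) := subset_trans sVG (normal_norm (char_normal_trans
  chx nKG)).
have nVy : V \subset 'N(<[y]>) := subset_trans sVG (normal_norm (char_normal_trans
  chy nKG)).
have uV u : u \in V -> u^-1 = u.
  by move=> /V2 u2; apply/eqP; rewrite eq_invg_mul -expg2 u2.
have abV : abelian V.
  apply/centsP=> u Vu v Vv; rewrite /commute -[LHS]uV ?groupM // invMg.
  by rewrite !uV.
have prx : prime #[x] by rewrite ox.
have pry : prime #[y] by rewrite oy.
have lx := card_cent_elementary prx nVx V2.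
have ly := card_cent_elementary pry nVy V2.
(* An element of V commuting with x and y commutes with K and with the abelian V, so it is central
   in G. *)
have ti : 'C_V[x] :&: 'C_V[y] = 1.
  apply/trivgP; rewrite -Z1; apply/subsetP=> c /setIP[/setIP[Vc cx] /setIP[_ cy]].
  rewrite inE (subsetP sVG) //= -defKV centM -defKm centM !cent_cycle.
  by rewrite inE (subsetP abV) // andbT inE cx.
have prodC : (#|'C_V[x]| * #|'C_V[y]|)%N = #|'C_V[x] * 'C_V[y]| by rewrite TI_cardMg.
have sC : 'C_V[x] * 'C_V[y] \subset V by rewrite mul_subG ?subsetIl.
have leC := subset_leq_card sC; rewrite -prodC oV in leC; rewrite oV in lx ly.
have [cx2 cy2] : #|'C_V[x]| = 2 /\ #|'C_V[y]| = 2.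
  move: lx ly leC; rewrite -[4]/(2 * 2)%N !leq_pmul2l //;
    move: #|_| #|_| => p q p2 q2 pq.
  split; apply/eqP; rewrite eqn_leq ?p2 ?q2 andbT -(@leq_pmul2l 2) //.
    by apply: leq_trans pq; rewrite mulnC leq_mul.
  by apply: leq_trans pq; rewrite leq_mul.
have defV : 'C_V[x] * 'C_V[y] = V by apply/eqP; rewrite eqEcard sC -prodC cx2 cy2 oV.
have /cyclicP[b defb] : cyclic 'C_V[x] by apply: prime_cyclic; rewrite cx2.
have /cyclicP[a defa] : cyclic 'C_V[y] by apply: prime_cyclic; rewrite cy2.
have ob : #[b] = 2 by rewrite /order -defb.
have oa : #[a] = 2 by rewrite /order -defa.
have /setIP[Vb Cbx] : b \in 'C_V[x] by rewrite defb cycle_id.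
have /setIP[Va Cay] : a \in 'C_V[y] by rewrite defa cycle_id.
have inv z w v : prime #[z] -> V \subset 'N(<[z]>) -> 'C_V[w] = <[v]> -> v \in V ->
  #[v] = 2 ->
     'C_V[z] :&: 'C_V[w] = 1 -> z ^ v = z^-1.
  move=> prz nVz defv Vv ov tizw.
  have [zv|//] := involution_prime_cycle prz (V2 v Vv) (subsetP nVz v Vv).
  have : v \in 'C_V[z] :&: 'C_V[w].
    rewrite inE defv cycle_id andbT inE Vv; apply/cent1P/commute_sym/commgP/conjg_fixP.
    exact: zv.
  by rewrite tizw => /set1P v1; rewrite v1 order1 in ov.
have xa : x ^ a = x^-1 by apply: (inv x y a).
have yb : y ^ b = y^-1 by apply: (inv y x b); rewrite // setIC.
pose D1 := (<[x]> <*> <[a]>)%G; pose D2 := (<[y]> <*> <[b]>)%G.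
have defD1 : D1 = <[x]> * <[a]> :> {set gT}.
  by rewrite /= norm_joinEr // cycle_subG (subsetP nVx).
have defD2 : D2 = <[y]> * <[b]> :> {set gT}.
  by rewrite /= norm_joinEr // cycle_subG (subsetP nVy).
have oD1 : #|D1| = 6.
  by rewrite defD1 TI_cardMg ?coprime_TIg // -/#[x] -/#[a] ox oa.
have oD2 : #|D2| = 10.
  by rewrite defD2 TI_cardMg ?coprime_TIg // -/#[y] -/#[b] oy ob.
have cD : D2 \subset 'C(D1).
  have ba : b \in 'C[a] by apply/cent1P; exact: (centsP abV).
  rewrite join_subG !cycle_subG /= centY !cent_cycle.
  apply/andP; split; apply/setIP; split=> //; last by rewrite cent1C.
  by rewrite -cent_cycle -cycle_subG.
have D12 : D1 * D2 = G.
  have cya : <[a]> * <[y]> = <[y]> * <[a]>.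
    by apply: normC; rewrite cycle_subG; apply: (subsetP nVy).
  rewrite defD1 defD2 mulgA -(mulgA <[x]>) cya mulgA defKm -mulgA.
  rewrite -defa -defb (normC (subset_trans (subsetIl _ _) _)) ?defV //.
  by rewrite (subset_trans (abV : V \subset 'C(V))) // (subset_trans _ (cent_sub
    _)) // centS // subsetIl.
have ti12 : D1 :&: D2 = 1.
  apply/eqP; rewrite trivg_card_le1; have := mul_cardG D1 D2;
    rewrite D12 oD1 oD2 oG => e.
  by rewrite -(@leq_pmul2l 60) // -e.
have defGD : D1 \x D2 = G by rewrite dprodE // D12.
have x3 : x ^+ 3 = 1 by rewrite -ox expg_order.
have y5 : y ^+ 5 = 1 by rewrite -oy expg_order.
have i1 : D1 \isog [set: 'D_6] := @dihedral_isog _ D1 3 x a isT erefl x3 (V2 a Va)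
  xa oD1.
have i2 : D2 \isog [set: 'D_10] := @dihedral_isog _ D2 5 y b isT erefl y5 (V2 b Vb)
  yb oD2.
exact: dprod_D3xD5 defGD i1 i2.
Qed.

(** * Klein Sylow subgroups with N(V) larger than C(V) *)

Lemma pgroup_cent_mod (gT : finGroupType) (p : nat) (P : {group gT}) (S : {set gT}) :
  p.-group P -> P \subset 'N(S) -> #|S| = #|'C_S(P)| %[mod p].
Proof.
move=> pP nSP; rewrite -afixJ; apply: pgroup_fix_mod => //.
by rewrite astabsJ.
Qed.

Section Klein.
Variables (gT : finGroupType) (V : {group gT}).
Hypotheses (oV : #|V| = 4) (V2 : forall u, u \in V -> u ^+ 2 = 1).

(** Conjugation by t permutes the three involutions of V. Having odd order it cannot act as a
    transposition, so once it moves v it is a 3-cycle. *)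
Lemma klein_cycle3 t v : odd #[t] -> t \in 'N(V) -> v \in V -> v ^ t != v ->
  (forall u, u \in V -> u != 1 -> [\/ u = v, u = v ^ t | u = v ^ (t ^+ 2)]) /\ v ^
    (t ^+ 3) = v.
Proof.
move=> odd_t nVt Vv nvt.
have nv1 : v != 1 by apply: contraNneq nvt => ->; rewrite conj1g.
have nvtt : v ^ (t ^+ 2) != v.
  (* [uphalf #[t]] inverts 2 modulo the odd order of t, so t is a power of t^2 and a fixed point of
     t^2 would be fixed by t. *)
  apply: contraNneq nvt => e; have ei i : v ^ (t ^+ 2 ^+ i) = v.
    by elim: i => [|i IH]; rewrite ?conjg1 // expgSr conjgM IH.
  rewrite -{2}(ei (uphalf #[t])) -expgM mul2n uphalf_half odd_t doubleD /=.
  have := odd_double_half #[t]; rewrite odd_t /= => e2.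
  by rewrite addSn e2 expgS expg_order mulg1.
have mem i : v ^ (t ^+ i) \in V by rewrite memJ_norm // groupX.
have nc i : v ^ (t ^+ i) != 1 by rewrite -(conj1g (t ^+ i)) (inj_eq (conjg_inj _)).
have nvt2 : v ^ (t ^+ 2) != v ^ t by rewrite expgS conjgM (inj_eq (conjg_inj _)).
have eqS : V^# = [set v; v ^ t; v ^ (t ^+ 2)].
  apply/esym/eqP; rewrite eqEcard; apply/andP; split.
    apply/subsetP=> u; rewrite !inE -orbA => /or3P[] /eqP->.
    - by rewrite nv1.
    - by have := mem 1%N; have := nc 1%N; rewrite expg1 => -> ->.
    - by rewrite nc mem.
  have := cardsD1 1 V; rewrite group1 oV add1n => -[<-].
  by rewrite setUC cardsU1 cards2 !inE (negPf nvtt) (negPf nvt2) eq_sym nvt.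
have cases u : u \in V -> u != 1 -> [\/ u = v, u = v ^ t | u = v ^ (t ^+ 2)].
  move=> Vu nu; have : u \in V^# by rewrite !inE nu.
  by rewrite eqS !inE -orbA => /or3P[] /eqP; [exact: Or31|exact: Or32|exact: Or33].
split=> //; have [//|e|e] := cases _ (mem 3) (nc 3).
  case/eqP: nvtt; apply: (conjg_inj t); rewrite -conjgM -expgSr.
  exact: e.
case/eqP: nvt; apply: (conjg_inj (t ^+ 2)); rewrite -conjgM -expgS.
exact: e.
Qed.

Lemma klein_abelian : abelian V.
Proof.
have iV u : u \in V -> u^-1 = u by move=> /V2 u2; apply/eqP;
  rewrite eq_invg_mul -expg2 u2.
by apply/centsP=> u Vu v Vv; rewrite /commute -[LHS]iV ?groupM // invMg !iV.
Qed.

(** Let s normalize but not centralize V. Its 2-part lies in V, which is abelian, so its odd part r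
    still moves some v. The order of r divides 15, and r^5 is the required element. *)
Lemma klein_order3 : #|gT| = 60 -> 2.-Sylow([set: gT]) V -> ~~ ('N(V) \subset 'C(V)) ->
  exists t, [/\ #[t] = 3, t \in 'N(V) & forall u, u \in V -> u != 1 -> u ^ t != u].
Proof.
move=> oG sylV /subsetPn[s Ns nCs].
have nVN : V <| 'N(V) := normalG V.
have sylVN : 2.-Sylow('N(V)) V := pHall_subl (normal_sub nVN) (subsetT _) sylV.
have abV := klein_abelian.
pose r := s.`_2^'; have Nr : r \in 'N(V) by rewrite groupX.
have Vs2 : s.`_2 \in V by rewrite (mem_normal_Hall sylVN nVN) ?p_elt_constt ?groupX.
have nCr : r \notin 'C(V).
  by apply: contra nCs => Cr; rewrite -(consttC 2 s) groupM // (subsetP abV).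
have odd_r : odd #[r].
  have := p_elt_constt 2^' s; rewrite -/r /p_elt p'natE //.
  by rewrite dvdn2 negbK.
have [v Vv nvr] : exists2 v, v \in V & v ^ r != v.
  apply/exists_inP; move: nCr; apply: contraR; rewrite negb_exists_in => /forall_inP H.
  apply/centP=> v Vv; apply/commute_sym/commgP/conjg_fixP.
  by have := H v Vv; rewrite negbK => /eqP.
have [_ vr3] := klein_cycle3 odd_r Nr Vv nvr.
have r15 : #[r] %| 15.
  rewrite -(@Gauss_dvdr _ 4) /= ?oG; last by rewrite (@coprimeXr 2 _ 2) // coprimen2.
  by rewrite -[(4 * 15)%N]/60 -oG -cardsT order_dvdG ?inE.
pose t := r ^+ 5; have Nt : t \in 'N(V) by rewrite groupX.
have nvt : v ^ t != v.
  (* r^3 fixes v, hence so does r^6; if r^5 fixed v as well, so would r. *)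
  apply: contraNneq nvr => vt;
    have vr6 : v ^ (r ^+ 6) = v by rewrite (expgM r 3 2) expgS conjgM expg1 !vr3.
  by rewrite -{1}vt -conjgM -expgSr vr6.
have t3 : t ^+ 3 = 1 by apply/eqP; rewrite -expgM -order_dvdn.
have ot : #[t] = 3.
  have : #[t] %| 3 by rewrite order_dvdn t3.
  rewrite dvdn_divisors // !inE => /orP[|/eqP//]; rewrite order_eq1 => /eqP t1.
  by rewrite t1 conjg1 eqxx in nvt.
exists t; split=> // u Vu nu; have odd_t : odd #[t] by rewrite ot.
have [cs _] := klein_cycle3 odd_t Nt Vv nvt.
have [->//|->|->] := cs u Vu nu; first by rewrite (inj_eq (conjg_inj _)).
by rewrite -conjgM -expgSr expgS conjgM (inj_eq (conjg_inj _)).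
Qed.

Section Order3.
Variable t : gT.
Hypotheses (ot : #[t] = 3) (Nt : t \in 'N(V)) (ntV : forall u, u \in V -> u != 1 ->
  u ^ t != u).
Hypotheses (oG : #|gT| = 60) (sylV : 2.-Sylow([set: gT]) V).

(** The powers of t carry u to each of the three involutions of V. *)
Lemma klein_sub (L : {group gT}) u : t \in 'N(L) -> u \in V -> u \in L -> u != 1 ->
  V \subset L.
Proof.
move=> NLt Vu Lu nu; have odd_t : odd #[t] by rewrite ot.
have [cs _] := klein_cycle3 odd_t Nt Vu (ntV Vu nu).
apply/subsetP=> w Vw; have [->|nw] := eqVneq w 1; first exact: group1.
by have [->|->|->] := cs w Vw nw; rewrite // memJ_norm // groupX.
Qed.

Lemma t_notin_cent : t \notin 'C(V).
Proof.
have [u Vu nu] : exists2 u, u \in V & u != 1.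
  by apply/trivgPn; rewrite trivg_card1 oV.
apply: contra (ntV Vu nu) => /centP/(_ u Vu) c.
by apply/eqP/conjg_fixP/commgP/commute_sym.
Qed.

Lemma exists_order5 : exists z : gT, #[z] = 5.
Proof.
have /(Cauchy (isT : prime 5))[z _ oz] : (5 %| #|[set: gT]|)%N by rewrite cardsT oG.
by exists z.
Qed.

Lemma card_multiple60 (L : {group gT}) z : #[z] = 5 ->
  V \subset L -> t \in L -> z \in L -> L = [set: gT] :> {set gT}.
Proof.
move=> oz sVL Lt Lz; apply/eqP; rewrite eqEcard subsetT cardsT oG /=.
have d4 : (4 %| #|L|)%N by rewrite -oV cardSg.
have d3 : (3 %| #|L|)%N by rewrite -ot order_dvdG.
have d5 : (5 %| #|L|)%N by rewrite -oz order_dvdG.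
have : (4 * (3 * 5) %| #|L|)%N by rewrite !Gauss_dvd ?d4 ?d3 ?d5.
exact: dvdn_leq.
Qed.

(** Suppose V is normal. An element z of order 5 acting on four points fixes them all, so C(V) has
    order 20, and Q = <[z]> is its normal Sylow 5-subgroup, hence normal in G. Then t fixes a number
    of points of Q that divides 5 and is 2 modulo 3, so all of them. Now V, t and z centralize Q,
    and z is central. *)
Lemma klein_not_normal : 'Z([set: gT]) = 1 -> 'N(V) != [set: gT].
Proof.
move=> Z1; apply/eqP=> NV; have [z oz] := exists_order5; pose Q := <[z]>%G.
have oQ : #|Q| = 5 := oz.
have pQ : 5.-group Q by rewrite /pgroup oQ.
have Nz : z \in 'N(V) by rewrite NV.
have cVQ : V \subset 'C(Q).
  have nVQ : Q \subset 'N(V) by rewrite cycle_subG.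
  have := pgroup_cent_mod pQ nVQ; rewrite oV => e;
    have := subset_leq_card (subsetIl V 'C(Q)).
  rewrite oV => le; suff /eqP <- : 'C_V(Q) == V by apply: subsetIr.
  rewrite eqEcard subsetIl oV; move: e le; move: #|_| => n.
  by case: n => [|[|[|[|[|n]]]]].
have sQC : Q \subset 'C(V) by rewrite centsC.
have tiVQ : V :&: Q = 1 by apply: coprime_TIg; rewrite oV oQ.
have sVQC : V * Q \subset 'C(V) by rewrite mul_subG //; exact: klein_abelian.
have oVQ : #|V * Q| = 20 by rewrite TI_cardMg // oV oQ.
have defC : V * Q = 'C(V).
  apply/eqP; rewrite eqEcard sVQC oVQ.
  have d4 : (4 %| #|'C(V)|)%N by rewrite -oV cardSg //; exact: klein_abelian.
  have d5 : (5 %| #|'C(V)|)%N by rewrite -oQ cardSg.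
  have /dvdnP[m em] : (4 * 5 %| #|'C(V)|)%N by rewrite Gauss_dvd ?d4.
  have : (#|'C(V)| %| 60)%N by rewrite -oG -cardsT cardSg ?subsetT.
  rewrite em -[60]/(3 * 20)%N dvdn_pmul2r // dvdn_divisors // !inE => /orP[] /eqP m3.
    by rewrite m3.
  have : 'C(V) = [set: gT] by apply/eqP; rewrite eqEcard subsetT cardsT oG em m3.
  by move=> CT; have := t_notin_cent; rewrite CT inE.
have nQC : Q <| 'C(V).
  by rewrite /normal sQC -defC mul_subG ?normG // (subset_trans cVQ) ?cent_sub.
have sylQ : 5.-Sylow('C(V)) Q by rewrite pHallE sQC oQ /= -defC oVQ p_part.
have chQ : Q \char 'C(V) by rewrite -(normal_Hall_pcore sylQ nQC) pcore_char.
have nQ : Q <| [set: gT].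
  by apply: char_normal_trans chQ _; rewrite /normal subsetT norms_cent // NV.
have nQt : <[t]> \subset 'N(Q).
  by apply: subset_trans (subsetT _) _; apply: normal_norm.
have p3 : 3.-group <[t]> by rewrite /pgroup -/#[t] ot.
have := pgroup_cent_mod p3 nQt; rewrite oQ => e.
have d5 : (#|'C_Q(<[t]>)| %| 5)%N by rewrite -oQ cardSg ?subsetIl.
have cQt : Q \subset 'C(<[t]>).
  suff /eqP <- : 'C_Q(<[t]>) == Q by apply: subsetIr.
  rewrite eqEcard subsetIl oQ; move: e d5; move: #|_| => n e.
  by rewrite dvdn_divisors // !inE => /orP[] /eqP n5; rewrite n5 // in e *.
have CQ : 'C(Q) = [set: gT].
  apply: (card_multiple60 (L := 'C(Q)%G) oz) => //=.
    by rewrite -cycle_subG centsC.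
  by rewrite -cycle_subG; exact: cycle_abelian.
have : z \in 'Z([set: gT]).
  rewrite inE in_setT -CQ; apply/centP=> c.
  by move/centP/(_ z (cycle_id z))/commute_sym.
by rewrite Z1 => /set1P z1; rewrite z1 order1 in oz.
Qed.

Lemma card_norm_klein : 'Z([set: gT]) = 1 -> #|'N(V)| = 12.
Proof.
move=> Z1; have d4 : (4 %| #|'N(V)|)%N by rewrite -oV cardSg ?normG.
have d3 : (3 %| #|'N(V)|)%N by rewrite -ot order_dvdG.
have /dvdnP[m em] : (4 * 3 %| #|'N(V)|)%N by rewrite Gauss_dvd ?d4.
have : (#|'N(V)| %| 60)%N by rewrite -oG -cardsT cardSg ?subsetT.
rewrite em -[60]/(5 * 12)%N dvdn_pmul2r // dvdn_divisors // !inE => /orP[] /eqP m5.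
  by rewrite m5.
have := klein_not_normal Z1; case/eqP.
by apply/eqP; rewrite eqEcard subsetT cardsT oG em m5.
Qed.

(** Meant for the kernel of the action on the cosets of N(V). If L meets V, it contains V by the
    3-cycle, and V, the unique Sylow 2-subgroup of N(V), is then normal in G. Otherwise [L, V] lies
    in the trivial group L :&: V, so L lies in C(V), which is V because its order is a multiple of 4
    dividing 12 and t is not in it. *)
Lemma norm_klein_core (L : {group gT}) : 'Z([set: gT]) = 1 ->
  L <| [set: gT] -> L \subset 'N(V) -> L :=: 1.
Proof.
move=> Z1 nL sLN; have oN := card_norm_klein Z1.
have nVN : V <| 'N(V) := normalG V.
have sylVN : 2.-Sylow('N(V)) V := pHall_subl (normal_sub nVN) (subsetT _) sylV.
have tiLV : L :&: V = 1.
  apply/eqP; apply: contraT => /trivgPn[u /setIP[Lu Vu] nu].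
  have NLt : t \in 'N(L) by rewrite (subsetP (normal_norm nL)) ?inE.
  have sVL := klein_sub NLt Vu Lu nu.
  have NT : 'N(V) = [set: gT].
    apply/eqP; rewrite eqEsubset subsetT; apply/subsetP=> g _; apply/normP.
    apply/eqP; rewrite eqEcard cardJg leqnn andbT; apply/subsetP=> _ /imsetP[w Vw ->].
    rewrite (mem_normal_Hall sylVN nVN).
      by rewrite /p_elt orderJ; apply: mem_p_elt Vw; rewrite /pgroup oV.
    apply: (subsetP sLN); rewrite memJ_norm ?(subsetP sVL) //.
    by rewrite (subsetP (normal_norm nL)) ?inE.
  by have := klein_not_normal Z1; rewrite NT eqxx.
have cLV : L \subset 'C(V).
  apply/commG1P/trivgP; rewrite -tiLV subsetI commg_subl commg_subr sLN andbT.
  by rewrite (subset_trans (subsetT V)) ?normal_norm.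
have sVC : V \subset 'C(V) by exact: klein_abelian.
have oC : #|'C(V)| = 4.
  have d4 : (4 %| #|'C(V)|)%N by rewrite -oV cardSg.
  have [m em] := dvdnP d4.
  have : (#|'C(V)| %| 12)%N by rewrite -oN cardSg ?cent_sub.
  rewrite em -[12]/(3 * 4)%N dvdn_pmul2r // dvdn_divisors // !inE => /orP[] /eqP m3.
    by rewrite m3.
  have : 'C(V) = 'N(V) by apply/eqP; rewrite eqEcard cent_sub oN em m3.
  by move=> CN; have := t_notin_cent; rewrite CN Nt.
have defC : V = 'C(V) :> {set gT} by apply/eqP; rewrite eqEcard sVC oC oV.
by rewrite -tiLV; apply/esym/setIidPl; rewrite defC.
Qed.
End Order3.
End Klein.

(** * The embedding into A_5 by the action on cosets *)

Lemma coset_perm (gT : finGroupType) (N : {group gT}) n : #|[set: gT] : N| = n ->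
  exists f : gT -> {perm 'I_n}, {morph f : x y / x * y} /\ forall g, f g = 1 ->
    forall x, g \in N :^ x.
Proof.
move=> cS; pose S := rcosets N [set: gT].
have NS : (N : {set gT}) \in S by apply/rcosetsP; exists 1; rewrite ?inE ?mulg1.
pose e (i : 'I_n) : {set gT} := enum_val (cast_ord (esym cS) i).
have eS i : e i \in S := enum_valP _.
have eI : injective e by move=> i j /enum_val_inj/cast_ord_inj.
have Sg A g : A \in S -> A :* g \in S.
  by case/rcosetsP=> x _ ->; rewrite -rcosetM; apply/rcosetsP; exists (x * g);
    rewrite ?inE.
pose h g i := cast_ord cS (enum_rank_in NS (e i :* g)).
have eh g i : e (h g i) = e i :* g.
  by rewrite /e /h cast_ordK enum_rankK_in // Sg.
have hI g : injective (h g).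
  by move=> i j /(congr1 e); rewrite !eh => /rcoset_inj/eI.
exists (fun g => perm (@hI g)); split=> [x y|g /permP fg x].
  by apply/permP=> i; rewrite permM !permE; apply: eI; rewrite !eh rcosetM.
have xS : N :* x \in S by apply: Sg.
pose i := cast_ord cS (enum_rank_in NS (N :* x)).
have ei : e i = N :* x by rewrite /e /i cast_ordK enum_rankK_in.
have := congr1 e (fg i); rewrite permE perm1 eh ei -rcosetM => /rcoset_eqP.
by rewrite mem_rcoset mem_conjg conjgE invgK mulgA.
Qed.

Lemma card_gen_involutions (gT : finGroupType) (a b : gT) : #[a] = 2 -> #[b] = 2 ->
  commute a b -> a != b -> #|<<[set a; b]>>| = 4.
Proof.
move=> oa ob cab nab.
have cb : <[b]> \subset 'C(<[a]>) by rewrite cycle_subG /= cent_cycle; apply/cent1P.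
have -> : <<[set a; b]>> = <[a]> * <[b]>.
  by rewrite -(cent_joinEr cb) -[<<_>>]/([set a] <*> [set b]) -joing_idl -joing_idr.
rewrite TI_cardMg -/#[a] -/#[b] ?oa ?ob //; apply: prime_TIg;
  first by rewrite -/#[a] oa.
apply: contra nab; rewrite cycle_subG /=.
have -> : <[b]> = [set 1; b].
  apply/eqP; rewrite eq_sym eqEcard subUset !sub1set group1 cycle_id -/#[b] ob cards2.
  by rewrite eq_sym -order_eq1 ob.
by rewrite !inE => /orP[/eqP a1|//]; rewrite a1 order1 in oa.
Qed.

(** This makes [H0] a Sylow 2-subgroup of A_5, so that Sylow conjugacy can move any subgroup of
    order 4 onto it. *)
Lemma card_H0 : #|H0| = 4.
Proof.
pose G := 'Alt_('I_5)%G.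
have aG : perm_12_34 \in G by rewrite Alt_even odd_permM !odd_tperm.
have bG : perm_13_24 \in G by rewrite Alt_even odd_permM !odd_tperm.
have a2 : perm_12_34 ^+ 2 = 1.
  apply/permP=> i; rewrite expgS expg1 !permM perm1 !permE /=.
  by case: i => [[|[|[|[|[|i]]]]] Hi] //; apply/val_inj.
have b2 : perm_13_24 ^+ 2 = 1.
  apply/permP=> i; rewrite expgS expg1 !permM perm1 !permE /=.
  by case: i => [[|[|[|[|[|i]]]]] Hi] //; apply/val_inj.
have cab : perm_12_34 * perm_13_24 = perm_13_24 * perm_12_34.
  apply/permP=> i; rewrite !permM !permE /=.
  by case: i => [[|[|[|[|[|i]]]]] Hi] //; apply/val_inj.
have val0 c : c = 1 :> {perm 'I_5} -> c (@Ordinal 5 0 isT) = 0 :> nat by move=> ->;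
  rewrite perm1.
have na : perm_12_34 != 1 by apply/eqP=> /val0; rewrite !permM !permE.
have nb : perm_13_24 != 1 by apply/eqP=> /val0; rewrite !permM !permE.
have nab : perm_12_34 != perm_13_24.
  apply/eqP=> /(congr1 (fun c : {perm 'I_5} => val (c (@Ordinal 5 0 isT)))).
  by rewrite /= !permM !permE.
have ord2 c : c \in G -> c ^+ 2 = 1 -> c != 1 -> #[subg G c] = 2.
  move=> cG c2 nc; rewrite order_injm ?injm_subg //; apply/prime_nt_dvdP => //.
    by rewrite order_eq1.
  by rewrite order_dvdn c2.
apply: card_gen_involutions; rewrite ?ord2 //.
  by rewrite /commute -!subgM // cab.
apply: contra nab => /eqP/(congr1 val) /=.
by rewrite !subgK // => ->.
Qed.

Lemma injective_hom_one (gT hT : finGroupType) (f : gT -> hT) : {morph f : x y / x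
  * y} ->
  (forall g, f g = 1 -> g = 1) -> injective f.
Proof.
move=> fM f1 x y exy; apply/eqP; rewrite eq_mulgV1; apply/eqP/f1.
have f11 : f 1 = 1 by apply: (mulgI (f 1)); rewrite -fM !mulg1.
by rewrite fM exy -fM mulgV.
Qed.

(** The action on the five cosets of N(V) is faithful by [norm_klein_core]. The elements acting
    evenly form a subgroup containing t and an element of order 5, both of odd order, and also V; by
    divisibility it is all of G. *)
Lemma klein_A5 (gT : finGroupType) (V : {group gT}) : #|gT| = 60 -> 'Z([set: gT]) = 1 ->
  #|V| = 4 -> (forall u, u \in V -> u ^+ 2 = 1) -> ~~ ('N(V) \subset 'C(V)) ->
  exists f : gT -> A5T, [/\ {morph f : x y / x * y}, injective f & f @: V = H0].
Proof.
move=> oG Z1 oV V2 nNC.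
have sylV : 2.-Sylow([set: gT]) V by rewrite pHallE subsetT oV cardsT oG p_part.
have [t [ot Nt ntV]] := klein_order3 oV V2 oG sylV nNC.
have oN := card_norm_klein oV V2 ot Nt ntV oG Z1.
have iN : #|[set: gT] : 'N(V)| = 5.
  by apply/eqP; rewrite -(@eqn_pmul2l 12) // -{1}oN Lagrange ?subsetT // cardsT oG.
have [f [fM f1]] := coset_perm iN.
have fI : injective f.
  apply: (injective_hom_one fM) => g fg.
  have f11 : f 1 = 1 by apply: (mulgI (f 1)); rewrite -fM !mulg1.
  have gs : group_set [set g | f g == 1].
    apply/group_setP; split=> [|x y]; first by rewrite inE f11.
    by rewrite !inE fM => /eqP-> /eqP->; rewrite mulg1.
  have K1 : Group gs :=: 1.
    apply: (norm_klein_core oV V2 ot Nt ntV oG sylV Z1).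
      rewrite /normal subsetT; apply/subsetP=> x _; rewrite inE;
        apply/subsetP=> _ /imsetP[y + ->].
      rewrite !inE conjgE !fM => /eqP->; rewrite mul1g -fM.
      by rewrite mulVg f11.
    apply/subsetP=> x; rewrite inE => /eqP/f1/(_ 1); rewrite conjsg1.
    by [].
  have : g \in [set g | f g == 1] by rewrite inE fg.
  by rewrite -[[set _ | _]]/(gval (Group gs)) K1 => /set1P.
have f11 : f 1 = 1 by apply: (mulgI (f 1)); rewrite -fM !mulg1.
have oddM x y : odd_perm (f (x * y)) = odd_perm (f x) (+) odd_perm (f y).
  by rewrite fM odd_permM.
have odd1 : odd_perm (f 1) = false by rewrite f11 odd_perm1.
have oddX x n : odd n -> x ^+ n = 1 -> odd_perm (f x) = false.
  have -> : odd_perm (f x) = odd_perm (f x) && true by rewrite andbT.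
  move=> <- xn; rewrite -odd1 -xn; elim: n {xn} => [|n IH]; first by rewrite andbF odd1.
  by rewrite expgS oddM -IH /=; case: (odd_perm _); case: (odd n).
have Ls : group_set [set g | ~~ odd_perm (f g)].
  apply/group_setP; split=> [|x y]; first by rewrite inE odd1.
  by rewrite !inE oddM => /negPf-> /negPf->.
have LT : Group Ls = [set: gT] :> {set gT}.
  have [z oz] := exists_order5 oG.
  have Lt : t \in Group Ls by rewrite inE (oddX t 3) // -ot expg_order.
  have Lz : z \in Group Ls by rewrite inE (oddX z 5) // -oz expg_order.
  apply: (card_multiple60 oV ot oG oz _ Lt Lz).
  have [v Vv nv] : exists2 v, v \in V & v != 1.
    by apply/trivgPn; rewrite trivg_card1 oV.
  have Vvt : v ^ t \in V by rewrite memJ_norm.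
  (* The conjugates v and v^t have the same parity, so their product is an even involution of V,
     from which t produces the others. *)
  apply: (klein_sub oV ot Nt ntV (u := v * v ^ t)).
  - exact: subsetP (normG _) _ Lt.
  - by rewrite groupM.
  - have LVt : t^-1 \in Group Ls by rewrite groupV.
    move: Lt LVt; rewrite !inE => /negPf Lt /negPf LVt.
    by rewrite oddM conjgE !oddM Lt LVt /= addbF addbb.
  apply/eqP=> e; case/eqP: (ntV v Vv nv); apply: (mulgI v).
  by rewrite e -expg2 V2.
have fAlt g : f g \in 'Alt_('I_5).
  have : g \in Group Ls by rewrite LT inE.
  by rewrite inE Alt_even.
pose F g : A5T := subg 'Alt_('I_5)%G (f g).
have FM : {morph F : x y / x * y} by move=> x y; rewrite /F fM subgM //; apply: fAlt.
have FI : injective F.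
  by move=> x y /(congr1 val); rewrite /= !subgK; try exact: fAlt; move/fI.
pose Fm := Morphism (in2W FM : {in [set: gT] &, {morph F : x y / x * y}}).
have oA : #|[set: A5T]| = 60.
  have := card_isog (isog_subg 'Alt_('I_5)%G) => <-.
  apply/eqP; rewrite -(@eqn_pmul2l 2) // card_Alt card_ord //.
have WE : F @: V = Fm @* V by rewrite morphimEsub ?subsetT.
have sylW : 2.-Sylow([set: A5T]) (Fm @* V).
  by rewrite pHallE subsetT oA p_part /= -WE card_imset // oV.
have sylH0 : 2.-Sylow([set: A5T]) <<H0>>.
  by rewrite pHallE subsetT oA p_part /= genGid card_H0.
(* The embedding is corrected by an inner automorphism of A_5 so that V lands exactly on [H0]. *)
have [x _] := Sylow_trans sylW sylH0; rewrite /= genGid => eH0.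
exists (fun g => F g ^ x); split.
- by move=> g h; rewrite FM conjMg.
- by move=> g h /conjg_inj/FI.
transitivity ((Fm @* V) :^ x); last exact: esym eH0.
by rewrite -WE /conjugate -imset_comp.
Qed.

Local Close Scope group_scope.
Import GRing.Theory.
Local Open Scope ring_scope.

(** * Group algebras and twists *)

(* The alias keeps convolution apart from the pointwise operations on {ffun gT -> k}. *)
Definition galg (k : fieldType) (gT : finGroupType) : Type := {ffun gT -> k}.

Section GroupAlgebra.
Variables (k : fieldType) (gT : finGroupType).
HB.instance Definition _ := Vector.copy (galg k gT) {ffun gT -> k^o}.
Implicit Types x y z : galg k gT.

Lemma galgP x y : (forall a, x a = y a) <-> x = y.
Proof. exact: ffunP. Qed.

Lemma convE x y a : conv x y a = \sum_g x g * y (g^-1 * a)%g.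
Proof. by rewrite ffunE. Qed.

Fact convA : associative (@conv k gT : galg k gT -> galg k gT -> galg k gT).
Proof.
move=> x y z; apply/ffunP=> a; rewrite !convE.
under eq_bigr do rewrite convE mulr_sumr.
under [RHS]eq_bigr do rewrite convE mulr_suml.
rewrite [RHS]exchange_big; apply: eq_bigr => g _ /=.
rewrite [RHS](reindex_inj (mulgI g)); apply: eq_bigr => h _.
by rewrite mulKg invMg -mulrA mulgA.
Qed.

Fact conv1x : left_id (Defs.one k gT : galg k gT) (@conv k gT).
Proof.
move=> x; apply/ffunP=> a; rewrite convE (bigD1 1%g) //= ffunE eqxx mul1r invg1 mul1g.
by rewrite big1 ?addr0 // => g /negPf ng; rewrite ffunE ng mul0r.
Qed.

Fact convx1 : right_id (Defs.one k gT : galg k gT) (@conv k gT).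
Proof.
move=> x; apply/ffunP=> a; rewrite convE (bigD1 a) //= ffunE mulVg eqxx mulr1.
rewrite big1 ?addr0 // => g ng; rewrite ffunE -eq_mulVg1.
by rewrite (negPf ng) mulr0.
Qed.

Lemma galg_addE x y a : (x + y) a = x a + y a.
Proof. by rewrite ffunE. Qed.

Lemma galg_scaleE (c : k) x a : (c *: x) a = c * x a.
Proof. by rewrite ffunE. Qed.

Fact convDl : left_distributive (@conv k gT : galg k gT -> galg k gT -> galg k gT) +%R.
Proof.
move=> x y z; apply/ffunP=> a; rewrite galg_addE !convE -big_split /=.
by apply: eq_bigr => g _; rewrite galg_addE mulrDl.
Qed.

Fact convDr : right_distributive (@conv k gT : galg k gT -> galg k gT -> galg k gT) +%R.
Proof.
move=> x y z; apply/ffunP=> a; rewrite galg_addE !convE -big_split /=.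
by apply: eq_bigr => g _; rewrite galg_addE mulrDr.
Qed.

Fact one_neq0 : (Defs.one k gT : galg k gT) != 0.
Proof. by apply/eqP=> /ffunP/(_ 1%g)/eqP; rewrite !ffunE eqxx oner_eq0. Qed.

HB.instance Definition _ := GRing.Zmodule_isNzRing.Build (galg k gT)
  convA conv1x convx1 convDl convDr one_neq0.

Fact convZl (c : k) x y : c *: (x * y) = (c *: x) * y.
Proof.
apply/ffunP=> a; rewrite galg_scaleE !convE mulr_sumr.
by apply: eq_bigr => g _; rewrite galg_scaleE mulrA.
Qed.

Fact convZr (c : k) x y : c *: (x * y) = x * (c *: y).
Proof.
apply/ffunP=> a; rewrite galg_scaleE !convE mulr_sumr.
by apply: eq_bigr => g _; rewrite galg_scaleE mulrCA.
Qed.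
HB.instance Definition _ := GRing.Lmodule_isLalgebra.Build k (galg k gT) convZl.
HB.instance Definition _ := GRing.Lalgebra_isAlgebra.Build k (galg k gT) convZr.
HB.instance Definition _ := Algebra_isFalgebra.Build k (galg k gT).

Lemma dim_galg : \dim {:galg k gT} = #|gT|.
Proof. by rewrite dimvf /dim /= muln1. Qed.
End GroupAlgebra.

Section Delta.
Variables (k : fieldType) (gT : finGroupType).
Implicit Types x y : galg k gT.

Definition gdelta (g : gT) : galg k gT := dlt k g.

Lemma galg_mulE x y a : (x * y) a = \sum_g x g * y (g^-1 * a)%g.
Proof. exact: convE. Qed.

Lemma galg_oneE a : (1 : galg k gT) a = (a == 1%g)%:R.
Proof. exact: ffunE. Qed.

Lemma galg_sumE (I : Type) (r : seq I) (P : pred I) (F : I -> galg k gT) a :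
  (\sum_(i <- r | P i) F i) a = \sum_(i <- r | P i) F i a.
Proof. exact: sum_ffunE. Qed.

Lemma gdeltaE g a : gdelta g a = (a == g)%:R.
Proof. exact: ffunE. Qed.

Lemma gdelta_mulE g x a : (gdelta g * x) a = x (g^-1 * a)%g.
Proof.
rewrite galg_mulE (bigD1 g) //= gdeltaE eqxx mul1r big1 ?addr0 // => h /negPf nh.
by rewrite gdeltaE nh mul0r.
Qed.

Lemma gdeltaM g h : gdelta g * gdelta h = gdelta (g * h)%g.
Proof. by apply/galgP=> a; rewrite gdelta_mulE !gdeltaE -(inj_eq (mulgI g)) mulKVg. Qed.

Lemma gdelta1 : gdelta 1%g = 1.
Proof. by []. Qed.

Lemma galg_sum x : x = \sum_g x g *: gdelta g.
Proof.
apply/galgP=> a; rewrite galg_sumE (bigD1 a) //= galg_scaleE gdeltaE eqxx mulr1.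
by rewrite big1 ?addr0 // => g ng; rewrite galg_scaleE gdeltaE eq_sym (negPf ng) mulr0.
Qed.

Lemma mul_sum x y : x * y = \sum_g \sum_h (x g * y h) *: gdelta (g * h)%g.
Proof.
rewrite {1}[x]galg_sum {1}[y]galg_sum mulr_suml; apply: eq_bigr => g _.
rewrite mulr_sumr; apply: eq_bigr => h _.
by rewrite -scalerAl -scalerAr scalerA gdeltaM.
Qed.

End Delta.

Section Push.
Variables (k : fieldType) (gT hT : finGroupType) (f : gT -> hT).
Implicit Types x y : galg k gT.

Definition push x : galg k hT := \sum_g x g *: gdelta k (f g).

Fact push_linear : linear push.
Proof.
move=> c x y; rewrite /push scaler_sumr -big_split; apply: eq_bigr => g _.
by rewrite galg_addE galg_scaleE scalerDl scalerA.
Qed.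
HB.instance Definition _ := GRing.isSemilinear.Build k (galg k gT) (galg k hT) _ push
  (GRing.semilinear_linear push_linear).

Lemma push_gdelta g : push (gdelta k g) = gdelta k (f g).
Proof.
rewrite /push (bigD1 g) //= gdeltaE eqxx scale1r big1 ?addr0 // => h nh.
by rewrite gdeltaE (negPf nh) scale0r.
Qed.

Lemma pushE x b : push x b = \sum_(a | f a == b) x a.
Proof.
rewrite galg_sumE [RHS]big_mkcond; apply: eq_bigr => g _.
by rewrite galg_scaleE gdeltaE eq_sym; case: eqP; rewrite ?mulr1 ?mulr0.
Qed.

Lemma push_mul x y : push (x * y) = \sum_g \sum_h (x g * y h) *: gdelta k (f (g * h)%g).
Proof.
rewrite mul_sum linear_sum; apply: eq_bigr => g _; rewrite linear_sum.
by apply: eq_bigr => h _; rewrite linearZ /= push_gdelta.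
Qed.

Lemma push_injE x a : injective f -> push x (f a) = x a.
Proof.
by move=> fI; rewrite pushE (eq_bigl (pred1 a)) ?big_pred1_eq // => b; apply: inj_eq.
Qed.

Lemma push_out x b : (forall a, f a != b) -> push x b = 0.
Proof. by move=> nb; rewrite pushE big_pred0 // => a; exact: negbTE (nb a). Qed.

Hypothesis fM : {morph f : a b / (a * b)%g}.

Lemma pushM : {morph push : x y / x * y}.
Proof.
move=> x y; rewrite push_mul [in RHS]/push mulr_suml; apply: eq_bigr => g _.
rewrite mulr_sumr; apply: eq_bigr => h _.
by rewrite -scalerAl -scalerAr scalerA gdeltaM fM.
Qed.

Lemma push1 : push 1 = 1.
Proof. by rewrite -gdelta1 push_gdelta -[f 1%g]mulg1 -(mulgV (f 1%g)) mulgA -fM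
  mulg1 mulgV gdelta1. Qed.

End Push.

Lemma push_comp (k : fieldType) (gT hT lT : finGroupType) (f : hT -> lT) (f' : gT -> hT)
  (x : galg k gT) : push f (push f' x) = push (f \o f') x.
Proof.
rewrite {2}/push linear_sum; apply: eq_bigr => g _.
by rewrite linearZ /= push_gdelta.
Qed.

Lemma push_id (k : fieldType) (gT : finGroupType) (x : galg k gT) : push id x = x.
Proof. by rewrite [RHS]galg_sum. Qed.

Lemma push_ext (k : fieldType) (gT hT : finGroupType) (f f' : gT -> hT)
  (x : galg k gT) : f =1 f' -> push f x = push f' x.
Proof. by move=> e; apply: eq_bigr => g _; rewrite e. Qed.

Lemma push_comm (k : fieldType) (gT hT lT : finGroupType) (f : gT -> lT) (f' : hT -> lT)
  (x : galg k gT) (y : galg k hT) :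
  (forall a b, commute (f a) (f' b)) -> push f x * push f' y = push f' y * push f x.
Proof.
move=> cf; rewrite /push mulr_suml mulr_sumr; apply: eq_bigr => g _.
rewrite mulr_sumr mulr_suml; apply: eq_bigr => h _.
by rewrite -!scalerAl -!scalerAr !gdeltaM cf !scalerA mulrC.
Qed.

(* All structure maps in the twist equation are linear extensions of group
   homomorphisms between powers of G: diag gives Delta, m12 and m23 give J (x) 1 and
   1 (x) J, d12 and d23 give Delta (x) id and id (x) Delta. *)
Section TensorMaps.
Variable gT : finGroupType.
Definition diag (g : gT) := (g, g).
Definition il (g : gT) : gT * gT := (g, 1%g).
Definition ir (g : gT) : gT * gT := (1%g, g).
Definition swap (p : gT * gT) := (p.2, p.1).
Definition d12 (p : gT * gT) := ((p.1, p.1), p.2).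
Definition d23 (p : gT * gT) := ((p.1, p.2), p.2).
Definition m12 (p : gT * gT) : (gT * gT) * gT := (p, 1%g).
Definition m23 (p : gT * gT) : (gT * gT) * gT := ((1%g, p.1), p.2).

Lemma diagM : {morph diag : x y / (x * y)%g}. Proof. by []. Qed.
Lemma ilM : {morph il : x y / (x * y)%g}. Proof. by move=> x y; congr (_, _);
  rewrite mulg1. Qed.
Lemma irM : {morph ir : x y / (x * y)%g}. Proof. by move=> x y; congr (_, _);
  rewrite mulg1. Qed.
Lemma swapM : {morph swap : x y / (x * y)%g}. Proof. by []. Qed.
Lemma d12M : {morph d12 : x y / (x * y)%g}. Proof. by []. Qed.
Lemma d23M : {morph d23 : x y / (x * y)%g}. Proof. by []. Qed.
Lemma m12M : {morph m12 : x y / (x * y)%g}. Proof. by move=> x y; congr (_, _);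
  rewrite mulg1. Qed.
Lemma m23M : {morph m23 : x y / (x * y)%g}. Proof. by move=> x y;
  congr ((_, _), _); rewrite mulg1. Qed.
Lemma fstM : {morph (@fst gT gT) : x y / (x * y)%g}. Proof. by []. Qed.
Lemma sndM : {morph (@snd gT gT) : x y / (x * y)%g}. Proof. by []. Qed.
End TensorMaps.
Arguments diag {gT}. Arguments il {gT}. Arguments ir {gT}. Arguments swap {gT}.
Arguments d12 {gT}. Arguments d23 {gT}. Arguments m12 {gT}. Arguments m23 {gT}.

Lemma left_right_inv_eq (T : nzRingType) (a b c : T) : b * a = 1 -> a * c = 1 -> b = c.
Proof. by move=> ba ac; rewrite -[b]mulr1 -ac mulrA ba mul1r. Qed.

(** The common shape of both sides of the twist equation for a gauge transform. P and D are images
    of Delta(x) and J; a c is the image of y (x) y. The factor a, on two legs, cancels against the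
    image a' of Delta(x), and c, on the remaining leg, slides past M. *)
Lemma gauge_twist_aux (R : nzRingType) (P D a c a' M O : R) :
  c * a' = a' * c -> a * a' = 1 -> c * M = M * c ->
  P * D * (a * c) * (a' * M * O) = P * (D * M) * (c * O).
Proof.
move=> ca aa cM; rewrite -!mulrA; congr (P * (D * _)).
by rewrite (mulrA c a') ca -mulrA (mulrA a) aa mul1r mulrA cM mulrA.
Qed.

(** * Twists and their gauge transforms *)

Section Twist.
Variables (k : fieldType) (gT : finGroupType).
Local Notation A := (galg k gT).
Local Notation A2 := (galg k (gT * gT)%type).
Implicit Types (x y u v : A) (J : A2).

Definition otimes u v : A2 := tens u v.

Lemma otimesE u v p : otimes u v p = u p.1 * v p.2.
Proof. exact: ffunE. Qed.

(** Factoring through the two leg inclusions reduces computations with tensors to multiplicativity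
    of [push]. *)
Lemma otimes_push u v : otimes u v = push il u * push ir v.
Proof.
apply/galgP=> p; rewrite otimesE galg_mulE (bigD1 (il p.1)) //= big1 ?addr0 => [|q nq].
  rewrite push_injE; last by move=> a b [].
  case: p => a b /=; rewrite (_ : (_ * _)%g = ir b); last first.
    congr (_, _); first exact: mulVg.
    exact: (etrans (congr1 (fun z => z * b)%g (@invg1 gT)) (mul1g b)).
  by rewrite [in RHS]push_injE // => ? ? [].
case: q nq => a b nq; case: (eqVneq b 1%g) nq => [->|nb] nq.
  rewrite [X in _ * X]push_out ?mulr0 // => c; apply: contraNneq nq => -[] /esym/eqP.
  by rewrite -eq_mulVg1 => /eqP->.
by rewrite push_out ?mul0r // => c; apply: contraNneq nb => -[_ ->].
Qed.

Lemma push_ir_il u v : push ir v * push il u = otimes u v.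
Proof. by rewrite otimes_push; apply: push_comm => a b; congr (_, _);
  rewrite ?mulg1 ?mul1g. Qed.

Lemma otimesM u v u' v' : otimes u v * otimes u' v' = otimes (u * u') (v * v').
Proof.
rewrite !otimes_push !pushM; [|exact: irM|exact: ilM].
by rewrite -!mulrA; congr (_ * _); rewrite !mulrA; congr (_ * _);
  rewrite push_ir_il -otimes_push.
Qed.

Lemma otimes1 : otimes 1 1 = 1.
Proof. by rewrite otimes_push !push1 ?mulr1 //; [exact: irM|exact: ilM]. Qed.

Lemma otimes_gdelta g h : otimes (gdelta k g) (gdelta k h) = gdelta k (g, h).
Proof. by rewrite otimes_push !push_gdelta gdeltaM; congr (gdelta k (_, _));
  rewrite ?mulg1 ?mul1g. Qed.

Lemma comulE x : comul x = push diag x.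
Proof.
apply/ffunP=> -[a b]; rewrite ffunE /=; case: eqVneq => [->|nab].
  by rewrite (@push_injE _ _ _ diag) // => ? ? [].
by rewrite push_out // => c; apply: contraNneq nab => -[-> ->].
Qed.

Lemma flipE J : flip J = push swap J.
Proof.
apply/ffunP=> -[a b]; rewrite ffunE -[(a, b)]/(swap (b, a)) push_injE //.
by move=> [? ?] [? ?] [-> ->].
Qed.

Lemma push_fstE J g : push fst J g = \sum_h J (g, h).
Proof.
rewrite pushE [LHS](eq_bigr (fun p => J (p.1, p.2))) => [|[]] //.
rewrite (eq_bigl (fun p => (p.1 == g) && true)) => [|p]; last by rewrite andbT.
by rewrite -(pair_big (fun i => i == g) xpredT (fun i j => J (i, j))) /= big_pred1_eq.
Qed.

Lemma push_sndE J h : push snd J h = \sum_g J (g, h).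
Proof.
rewrite pushE [LHS](eq_bigr (fun p => J (p.1, p.2))) => [|[]] //.
by rewrite -(pair_big xpredT (fun i => i == h) (fun i j => J (i, j))) /=
  exchange_big big_pred1_eq.
Qed.

Lemma push_d12E J : [ffun q : (gT * gT) * gT => if q.1.1 == q.1.2 then J (q.1.1,
  q.2) else 0] = push d12 J.
Proof.
apply/ffunP=> -[[a b] c]; rewrite ffunE /=; case: eqVneq => [->|nab].
  by rewrite -[(b, b, c)]/(d12 (b, c)) push_injE // => -[? ?] [? ?] [-> _ ->].
by rewrite push_out // => -[d e]; apply: contraNneq nab => -[-> ->].
Qed.

Lemma push_d23E J : [ffun q : (gT * gT) * gT => if q.1.2 == q.2 then J q.1 else 0]
  = push d23 J.
Proof.
apply/ffunP=> -[[a b] c]; rewrite ffunE /=; case: eqVneq => [->|nab].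
  by rewrite -[(a, c, c)]/(d23 (a, c)) push_injE // => -[? ?] [? ?] [-> -> _].
by rewrite push_out // => -[d e]; apply: contraNneq nab => -[_ -> ->].
Qed.

Lemma push_m12E J : [ffun q : (gT * gT) * gT => J q.1 * (q.2 == 1%g)%:R] = push m12 J.
Proof.
apply/ffunP=> -[p c]; rewrite ffunE /=; case: eqVneq => [->|nc].
  by rewrite mulr1 -[(p, _)]/(m12 p) push_injE // => ? ? [].
by rewrite mulr0 push_out // => d; apply: contraNneq nc => -[_ ->].
Qed.

Lemma push_m23E J : [ffun q : (gT * gT) * gT => (q.1.1 == 1%g)%:R * J (q.1.2, q.2)]
  = push m23 J.
Proof.
apply/ffunP=> -[[a b] c]; rewrite ffunE /=; case: eqVneq => [->|na].
  by rewrite mul1r -[(_, _, c)]/(m23 (b, c)) push_injE // => -[? ?] [? ?] [-> ->].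
by rewrite mul0r push_out // => -[d e]; apply: contraNneq na => -[->].
Qed.

Lemma is_twistP J : is_twist J <->
  [/\ exists J', J * J' = 1 /\ J' * J = 1,
      push d12 J * push m12 J = push d23 J * push m23 J,
      push snd J = 1 & push fst J = 1].
Proof.
rewrite /is_twist /twist_eq push_d12E push_d23E push_m12E push_m23E; split.
  case=> iJ [tJ [c1 c2]]; split=> //; apply/galgP=> a.
    by rewrite push_sndE c1 galg_oneE.
  by rewrite push_fstE c2 galg_oneE.
case=> iJ tJ c1 c2; split=> //; split=> //; split=> a.
  by rewrite -push_sndE c1 galg_oneE.
by rewrite -push_fstE c2 galg_oneE.
Qed.

(** Delta is symmetric, and the inverse of a symmetric J is symmetric by uniqueness of inverses. *)
Lemma sym_cocomm J : push swap J = J -> cocomm J.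
Proof.
move=> sJ J' [JJ' J'J] x; rewrite flipE.
have sJ' : push swap (J' : A2) = J'.
  by apply: (@left_right_inv_eq _ J) => //;
    rewrite -[in LHS]sJ -pushM ?[_ * _]J'J ?push1 //; exact: swapM.
rewrite /comulJ comulE; change (push swap ((J' : A2) * (push diag x * J)) = (J' :
  A2) * (push diag x * J)).
by rewrite !(pushM (@swapM gT)) sJ sJ' push_comp.
Qed.

(** [y] plays the part of the inverse of x and is supplied by the caller. *)
Definition gauge J x y : A2 := push diag x * J * otimes y y.

(** J is recovered from its gauge transform by the inverse transform, whose two outer factors are
    symmetric. *)
Lemma gauge_sym J x y : y * x = 1 -> push swap (gauge J x y) = gauge J x y -> push
  swap J = J.
Proof.
move=> yx sg.
have -> : J = push diag y * gauge J x y * otimes x x.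
  rewrite /gauge !mulrA -pushM // yx push1 // mul1r -mulrA otimesM yx otimes1.
  by rewrite mulr1.
rewrite 2!(pushM (@swapM gT)) sg push_comp; congr (_ * _ * _).
by rewrite {1}otimes_push (pushM (@swapM gT)) !push_comp; exact: push_ir_il.
Qed.

Lemma push_cst (hT : finGroupType) x (h : hT) : push (fun=> h) x = counit x *:
  gdelta k h.
Proof. by rewrite /push -scaler_suml. Qed.

Lemma push_snd_otimes u v : push snd (otimes u v) = counit u *: v.
Proof.
by rewrite otimes_push (pushM (@sndM gT)) !push_comp push_cst push_id gdelta1
  -scalerAl mul1r.
Qed.

Lemma push_fst_otimes u v : push fst (otimes u v) = counit v *: u.
Proof.
by rewrite otimes_push (pushM (@fstM gT)) !push_comp push_cst push_id gdelta1
  -scalerAr mulr1.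
Qed.

Lemma counit1 : counit (1 : A) = 1.
Proof. by rewrite /counit (bigD1 1%g) //= galg_oneE eqxx big1 ?addr0 // => g /negPf
  ng; rewrite galg_oneE ng. Qed.

Lemma counitM x y : counit (x * y) = counit x * counit y.
Proof.
have /galgP/(_ 1%g) : push (fun _ : gT => 1%g : gT) (x * y) = push (fun=> 1%g) x *
  push (fun=> 1%g) y.
  by apply: pushM => a b; rewrite mulg1.
by rewrite !push_cst gdelta1 -scalerAl -scalerAr mulr1 scalerA !galg_scaleE
  galg_oneE eqxx !mulr1.
Qed.

(** The condition [counit x = 1] is what preserves the two counit normalizations of a twist. *)
Lemma gauge_twist J x y : x * y = 1 -> y * x = 1 -> counit x = 1 ->
  is_twist J -> is_twist (gauge J x y).
Proof.
move=> xy yx ex /is_twistP[[J' [JJ' J'J]] tJ c1 c2]; apply/is_twistP.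
have ey : counit y = 1 by rewrite -[LHS]mul1r -[in LHS]ex -counitM xy counit1.
split.
- exists (otimes x x * J' * push diag y); rewrite /gauge; split.
    rewrite -!mulrA (mulrA (otimes y y)) otimesM yx otimes1 mul1r (mulrA J) JJ' mul1r.
    by rewrite -pushM // xy push1.
  rewrite -!mulrA (mulrA (push diag y)) -pushM // yx push1 // mul1r (mulrA J') J'J
    mul1r.
  by rewrite otimesM xy otimes1.
(* Embeddings of G into one or two of the three legs; images on disjoint legs commute. *)
- pose e3 (g : gT) : (gT * gT) * gT := ((1%g, 1%g), g).
  pose e1 (g : gT) : (gT * gT) * gT := ((g, 1%g), 1%g).
  pose e12 (g : gT) : (gT * gT) * gT := ((g, g), 1%g).
  pose e23 (g : gT) : (gT * gT) * gT := ((1%g, g), g).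
  have e12M : {morph e12 : a b / (a * b)%g} by move=> a b; congr (_, _); rewrite mulg1.
  have e23M : {morph e23 : a b / (a * b)%g} by move=> a b; congr ((_, _), _);
    rewrite mulg1.
  rewrite /gauge !(pushM (@d12M gT), pushM (@d23M gT), pushM (@m12M gT), pushM
    (@m23M gT)).
  have -> : push d12 (otimes y y) = push e12 y * push e3 y.
    by rewrite otimes_push (pushM (@d12M gT)) !push_comp.
  have -> : push d23 (otimes y y) = push e23 y * push e1 y.
    by rewrite -push_ir_il (pushM (@d23M gT)) !push_comp.
  have -> : push m12 (push diag x) = push e12 x by rewrite push_comp.
  have -> : push m23 (push diag x) = push e23 x by rewrite push_comp.
  have c3 z K : push e3 z * push m12 K = push m12 K * push e3 z.
    by apply: push_comm => a b; congr (_, _); rewrite ?mulg1 ?mul1g.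
  have c1' z K : push e1 z * push m23 K = push m23 K * push e1 z.
    by apply: push_comm => a b; congr ((_, _), _); rewrite ?mulg1 ?mul1g.
  have c312 : push e3 y * push e12 x = push e12 x * push e3 y.
    by apply: push_comm => a b; congr ((_, _), _); rewrite ?mulg1 ?mul1g.
  have c123 : push e1 y * push e23 x = push e23 x * push e1 y.
    by apply: push_comm => a b; congr ((_, _), _); rewrite ?mulg1 ?mul1g.
  rewrite !gauge_twist_aux ?c3 ?c1' //; try by rewrite -pushM // yx push1.
  rewrite tJ !push_comp; congr (_ * _ * _).
  rewrite -c1' !otimes_push (pushM (@m12M gT)) (pushM (@m23M gT)) !push_comp.
  by rewrite [RHS]mulrA.
- rewrite /gauge !(pushM (@sndM gT)) c1 push_snd_otimes ey scale1r mulr1 push_comp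
  push_id.
  exact: xy.
- rewrite /gauge !(pushM (@fstM gT)) c2 push_fst_otimes ey scale1r mulr1 push_comp
  push_id.
  exact: xy.
Qed.
End Twist.

(** In finite dimension right multiplication by y, being onto since v = (v x) y, is injective; it
    sends both y x and 1 to y. *)
Lemma galg_mulV (k : fieldType) (gT : finGroupType) (x y : galg k gT) :
  x * y = 1 -> y * x = 1.
Proof.
move=> xy; have sy : limg (amulr y) = fullv.
  apply/eqP; rewrite eqEsubv subvf; apply/subvP=> v _.
  have -> : v = amulr y (v * x) by rewrite lfunE /= -mulrA xy mulr1.
  by rewrite memv_img ?memvf.
have /lker0P iy : lker (amulr y) == 0%VS.
  have := limg_ker_dim (amulr y) fullv; rewrite sy capfv => /eqP.
  by rewrite -[X in _ == X]add0n eqn_add2r dimv_eq0.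
by apply: iy; rewrite !lfunE /= -mulrA xy mulr1 mul1r.
Qed.

Lemma push_mul2 (k : fieldType) (gT hT lT mT : finGroupType) (f : lT -> mT) (h : gT
  -> lT)
  (h' : hT -> lT) (x : galg k gT) (y : galg k hT) :
  push f (push h x * push h' y) = \sum_p \sum_q (x p * y q) *: gdelta k (f (h p *
    h' q)%g).
Proof.
rewrite {2}/push mulr_suml linear_sum; apply: eq_bigr => p _.
rewrite /push mulr_sumr linear_sum; apply: eq_bigr => q _.
by rewrite -scalerAl -scalerAr scalerA linearZ /= gdeltaM push_gdelta.
Qed.

Lemma In_mem (T : eqType) (x : T) (s : seq T) : List.In x s <-> x \in s.
Proof.
elim: s => //= y s IH; rewrite inE IH; split=> [[->|->]|/orP[/eqP->|]];
  rewrite ?eqxx ?orbT //.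
  by left.
by right.
Qed.

(** * Twisted antipode and central Hopf subalgebras *)

Section Antipode.
Variables (k : fieldType) (gT : finGroupType).
Local Notation A := (galg k gT).
Local Notation A2 := (galg k (gT * gT)%type).
Implicit Types (x y m : A) (s t J : A2).

(* The action of kG (x) kG on kG by (a (x) b) m = a m S(b). *)
Definition biact s m : A := \sum_p s p *: (gdelta k p.1 * m * gdelta k p.2^-1).

Lemma biact_scale s m c : biact s (c *: m) = c *: biact s m.
Proof.
rewrite /biact scaler_sumr; apply: eq_bigr => p _.
by rewrite -scalerAr -scalerAl !scalerA mulrC.
Qed.

Lemma biact_gdelta p m : biact (gdelta k p) m = gdelta k p.1 * m * gdelta k p.2^-1.
Proof.
rewrite /biact (bigD1 p) //= gdeltaE eqxx scale1r big1 ?addr0 // => q nq.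
by rewrite gdeltaE (negPf nq) scale0r.
Qed.

Lemma biact_suml (I : finType) (F : I -> k) (G : I -> gT * gT) m :
  biact (\sum_i F i *: gdelta k (G i)) m = \sum_i F i *: biact (gdelta k (G i)) m.
Proof.
rewrite {1}/biact [LHS](eq_bigr (fun p => \sum_i (F i * gdelta k (G i) p) *:
  (gdelta k p.1 * m * gdelta k p.2^-1))).
  rewrite exchange_big; apply: eq_bigr => i _ /=; rewrite /biact scaler_sumr.
  by apply: eq_bigr => p _; rewrite scalerA.
by move=> p _; rewrite galg_sumE scaler_suml; apply: eq_bigr => i _;
  rewrite galg_scaleE.
Qed.

Lemma biactM s t m : biact (s * t) m = biact s (biact t m).
Proof.
rewrite mul_sum pair_big_dep /= biact_suml -(pair_big_dep xpredT (fun _ => xpredT)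
  (fun p q => (s p * t q) *: biact (gdelta k (p * q)%g) m)) /= {2}/biact.
apply: eq_bigr => p _; rewrite {2}/biact mulr_sumr mulr_suml scaler_sumr.
apply: eq_bigr => q _; rewrite biact_gdelta -scalerAr -scalerAl scalerA; congr (_ *: _).
by rewrite invMg -!gdeltaM !mulrA.
Qed.

Lemma biact1 m : biact 1 m = m.
Proof. by rewrite -gdelta1 biact_gdelta /= invg1 gdelta1 mul1r mulr1. Qed.

Lemma biact_diag x : biact (push diag x) 1 = counit x *: 1.
Proof.
rewrite /push biact_suml /counit scaler_suml; apply: eq_bigr => g _.
by rewrite biact_gdelta mulr1 gdeltaM mulgV gdelta1.
Qed.

Lemma vJE J : vJ J = push (fun p => p.1^-1 * p.2)%g J.
Proof.
apply/ffunP=> a; rewrite ffunE pushE.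
rewrite (reindex_onto (fun g => (g, g * a)%g) fst) /=;
  last by move=> [g h] /= /eqP <-; rewrite mulKVg.
by apply: eq_bigl => g; rewrite mulKg !eqxx.
Qed.

(* Apply x (x) y (x) z |-> S(x) y S(z) to both sides of
   (J (x) 1)(1 (x) J^-1) = (Delta (x) id)(J^-1) (id (x) Delta)(J). *)
Lemma vJ_inv J J' : is_twist J -> J * J' = 1 -> J' * J = 1 ->
  (vJ J : A) * biact J' 1 = 1.
Proof.
move=> /is_twistP[_ tJ c1 c2] JJ' J'J.
have e : push m12 J * push m23 J' = push d12 J' * push d23 J.
  have /(congr1 (fun z => push d12 J' * z * push m23 J')) := tJ.
  rewrite -!mulrA -(pushM (@m23M gT)) JJ' push1 ?mulr1; last exact: m23M.
  by move=> <-; rewrite (mulrA (push d12 J')) -(pushM (@d12M gT)) J'J push1 ?mul1r.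
pose f (q : (gT * gT) * gT) := (q.1.1^-1 * q.1.2 * q.2^-1)%g.
have s2' : push snd J' = 1.
  by rewrite -[LHS]mulr1 -c1 -(pushM (@sndM gT)) J'J push1.
have := congr1 (push f) e; rewrite !push_mul2 => ef.
transitivity (\sum_p \sum_q (J p * J' q) *: gdelta k (f (m12 p * m23 q)%g)).
  rewrite vJE /push mulr_suml; apply: eq_bigr => p _.
  rewrite /biact mulr_sumr; apply: eq_bigr => q _.
  rewrite -scalerAl -scalerAr scalerA mulr1 !gdeltaM /f /=; congr (_ *: gdelta k _).
  by rewrite mulg1 mul1g !mulgA.
rewrite ef.
transitivity (push (fun g => g^-1)%g (push fst J) * push (fun g => g^-1)%g (push
  snd J')).
  rewrite !push_comp {1}/push mulr_suml exchange_big; apply: eq_bigr => q _ /=.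
  rewrite /push mulr_sumr; apply: eq_bigr => p _.
  rewrite -scalerAl -scalerAr scalerA gdeltaM mulrC /f /=; congr (_ *: gdelta k _).
  by rewrite !invMg !mulgA mulgKV mulgK.
by rewrite s2' c2 -gdelta1 push_gdelta gdeltaM invg1 mulg1.
Qed.

Lemma central_comm x y : (forall a b, x a != 0 -> commute a b) -> x * y = y * x.
Proof.
move=> cx; rewrite [x]galg_sum mulr_suml mulr_sumr; apply: eq_bigr => g _.
have [->|ng] := eqVneq (x g) 0; first by rewrite scale0r mul0r mulr0.
rewrite -scalerAl -scalerAr; congr (_ *: _).
rewrite [y]galg_sum mulr_suml mulr_sumr; apply: eq_bigr => h _.
by rewrite -scalerAl -scalerAr !gdeltaM cx.
Qed.

Lemma antipodeE x : antipode x = push (fun g => g^-1)%g x.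
Proof.
apply/ffunP=> a; rewrite ffunE -[a in RHS]invgK [RHS](@push_injE _ _ _ (fun g =>
  g^-1)%g) //.
exact: invg_inj.
Qed.

End Antipode.

Lemma diag_central (k : fieldType) (gT : finGroupType) (x : galg k gT) (t : galg k
  (gT * gT)%type) :
  (forall a b, x a != 0 -> commute a b) -> push diag x * t = t * push diag x.
Proof.
move=> cx; apply: central_comm => -[a b] [c d].
have [<-|nab] := eqVneq a b.
  rewrite -[(a, a)]/(diag a) push_injE => [na|? ? []//].
  by congr (_, _); apply: cx.
have -> : push diag x (a, b) = 0 by apply: push_out => e;
  apply: contraNneq nab => -[-> ->].
by rewrite eqxx.
Qed.

(** The span B of a central subgroup of prime order does not see the twist: on it Delta^J and S^J
    agree with Delta and S, and the adjoint action is h.x = eps(h) x. As |G| is not prime, B is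
    neither k nor everything. *)
Lemma simple_center (k : fieldType) (gT : finGroupType) (J : galg k (gT * gT)%type) :
  is_twist J -> hopf_simple J -> ~~ prime #|gT| -> 'Z([set: gT])%g = 1%g.
Proof.
move=> tJ sJ npr; apply: contraNeq npr => ntZ.
have [J' [JJ' J'J]] : exists J', (J * J' = 1) /\ (J' * J = 1) by case/is_twistP: tJ.
have vQ := vJ_inv tJ JJ' J'J; set Q := biact J' 1 in vQ.
have Qv := galg_mulV vQ.
have [p pr_p /(Cauchy pr_p)[z Zz oz]] : exists2 p, prime p & (p %| #|'Z([set:
  gT])%g|)%N.
  exists (pdiv #|'Z([set: gT])%g|); last exact: pdiv_dvd.
  by rewrite pdiv_prime // cardG_gt1.
have cz a b : a \in <[z]>%g -> commute a b.
  move=> az; have /centerP[_ ca] : a \in 'Z([set: gT])%g.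
    by move: a az; apply/subsetP; rewrite cycle_subG.
  by apply: ca; rewrite inE.
pose B (x : galg k gT) := forall a, a \notin <[z]>%g -> x a = 0.
have cB (x : galg k gT) : B x -> forall a b, x a != 0 -> commute a b.
  move=> Bx a b; have [az _|/Bx->] := boolP (a \in <[z]>%g); first exact: cz.
  by rewrite eqxx.
have z1 : z != 1%g by rewrite -order_gt1 oz prime_gt1.
have nB : normal_hopf_sub J J' Q B.
  split; first by move=> a _; rewrite ffunE.
  split; first by move=> c x y Bx By a na; rewrite ffunE Bx // By // mulr0 addr0.
  split.
    move=> a na; rewrite [LHS]galg_oneE; case: eqP na => // ->.
    by rewrite group1.
  split.
    move=> x y Bx By a na; rewrite convE big1 // => g _.
    have [gz|/Bx->] := boolP (g \in <[z]>%g); last by rewrite mul0r.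
    by rewrite By ?mulr0 // groupMl ?groupV.
  split.
    move=> x Bx; have sE : comulJ J J' x = push diag x.
      rewrite /comulJ comulE; change (J' * (push diag x * J) = push diag x).
      by rewrite diag_central ?mulrA ?J'J ?mul1r //; exact: cB.
    exists [seq ((x g *: gdelta k g : galg k gT), gdelta k g) | g <- enum <[z]>%g];
      split.
      move=> q /In_mem/mapP[g]; rewrite mem_enum => gz -> /=; split=> a na.
        by rewrite [LHS]galg_scaleE gdeltaE; case: eqP na => [->|_ _];
          rewrite ?gz ?mulr0.
      by rewrite [LHS]gdeltaE; case: eqP na => [->|//]; rewrite gz.
    rewrite sE; apply/ffunP=> q; rewrite [RHS]ffunE big_map big_enum /=.
    rewrite galg_sumE (bigID (mem <[z]>%g)) /= [X in _ + X]big1 ?addr0 => [|g];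
      last first.
      by move=> /Bx xg; rewrite galg_scaleE xg mul0r.
    apply: eq_bigr => g _; rewrite galg_scaleE -otimes_gdelta otimesE.
    by rewrite [RHS]ffunE galg_scaleE mulrA.
  split.
    move=> x Bx; have Sx : B (antipode x).
      by move=> a na; rewrite ffunE Bx // groupV.
    suff -> : antipJ J Q x = antipode x by [].
    rewrite /antipJ; change (Q * ((antipode x : galg k gT) * vJ J) = antipode x).
    by rewrite [X in _ * X]central_comm ?mulrA ?Qv ?mul1r //; exact: cB.
  move=> h; change (forall x : galg k gT, B x -> B (adJ J J' Q h x)) => x Bx.
  suff -> : adJ J J' Q h x = (counit h *: x : galg k gT).
    by move=> a na; rewrite [LHS]galg_scaleE Bx ?mulr0.
  (* Being central, x comes out in front of the sum of h_1 S^J(h_2). The rest is an action of J^-1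
     Delta(h) J on [Q]: J takes [Q] to 1, Delta(h) takes 1 to eps(h), J^-1 takes 1 back to [Q], and
     [Q] is inverse to [vJ J]. *)
  have -> : adJ J J' Q h x = (x : galg k gT) * (biact (J' * (push diag h * J)) Q *
    vJ J).
    apply/ffunP=> a; rewrite [LHS]ffunE /comulJ comulE mulr_suml mulr_sumr galg_sumE.
    apply: eq_bigr => r _; rewrite -scalerAl -scalerAr galg_scaleE; congr (_ * _).
    rewrite /antipJ antipodeE push_gdelta.
    change ((gdelta k r.1 * x * (Q * (gdelta k r.2^-1 * vJ J))) a = (x * (gdelta k
      r.1 * Q * gdelta k r.2^-1 * vJ J)) a).
    by rewrite -(central_comm (gdelta k r.1) (cB _ Bx)) !mulrA.
  rewrite !biactM -(biactM J J') JJ' biact1 biact_diag biact_scale -/Q.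
  by rewrite -scalerAl Qv -scalerAr mulr1.
have [tr|al] := sJ J' Q (conj JJ' J'J) (conj vQ Qv) B nB.
  have /tr[c /ffunP/(_ z)] : B (gdelta k z).
    by move=> a; rewrite [gdelta k z a]gdeltaE; case: eqP => // ->; rewrite cycle_id.
  rewrite [LHS]gdeltaE eqxx ffunE [X in c * X]galg_oneE (negPf z1) mulr0 => /eqP.
  by rewrite oner_eq0.
suff -> : #|gT| = p by [].
rewrite -oz -cardsT; congr #|pred_of_set _|; apply/setP=> a; rewrite inE; apply/esym.
apply: contraT => /(al (gdelta k a)) /eqP; rewrite [X in X == _]gdeltaE eqxx oner_eq0.
by [].
Qed.

(** * Simple modules of the dual algebra *)

Section Burnside.
Variables (k : closedFieldType) (n : nat) (S : {vspace 'M[k]_n}).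
Hypothesis SM : forall X Y, X \in S -> Y \in S -> X *m Y \in S.
Hypothesis S1 : 1%:M \in S.
Hypothesis Sirr : forall m (U : 'M[k]_(m, n)),
  (forall X, X \in S -> (U *m X <= U)%MS) -> U = 0 \/ row_full U.

Let b := vbasis S.
Let bS i : b`_i \in S.
Proof.
have [lt|ge] := ltnP i (\dim S); last by rewrite nth_default ?mem0v // size_tuple.
by rewrite vbasis_mem // mem_nth // size_tuple.
Qed.

(** The rows of [U] span v S, which contains v and is stable under S; irreducibility makes it the
    whole space. *)
Lemma orbit_full (v w : 'rV[k]_n) : v != 0 -> exists2 X, X \in S & v *m X = w.
Proof.
move=> nzv; pose U := \matrix_(i < \dim S) (v *m b`_i).
have inU X : X \in S -> (v *m X <= U)%MS.
  move=> XS; rewrite (coord_vbasis XS) mulmx_sumr summx_sub // => i _.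
  rewrite -scalemxAr scalemx_sub //; apply: submx_trans (row_sub i U).
  by rewrite rowK.
have [U0|/row_fullP[B BU]] : U = 0 \/ row_full U.
- apply: Sirr => X XS; apply/row_subP=> i.
  by rewrite row_mul rowK -mulmxA inU // SM.
- have := inU _ S1; rewrite mulmx1 U0 => /submx0null v0.
  by rewrite v0 eqxx in nzv.
exists (\sum_i (w *m B) 0 i *: b`_i).
  by apply: memv_suml => i _; rewrite memvZ.
rewrite mulmx_sumr -[RHS]mulmx1 -BU mulmxA [RHS]mulmx_sum_row.
by apply: eq_bigr => i _; rewrite rowK scalemxAr.
Qed.

(* If v1 T and v2 T are independent and v1 T X = v2, then T X T - l T has smaller rank
   for an eigenvalue l of X T on the row space of T, and is not zero. *)
Lemma rank_drop (T : 'M[k]_n) : T \in S -> (1 < \rank T)%N ->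
  exists T', [/\ T' \in S, T' != 0 & (\rank T' < \rank T)%N].
Proof.
move=> TS rT; have rT0 := ltnW rT.
pose i0 := Ordinal rT0; pose i1 := Ordinal rT.
have [C' C'C] := row_fullP (col_base_full T).
have [R' RR'] := row_freeP (row_base_free T).
have eT := mulmx_base T; set C := col_base T in C'C eT;
  set R := row_base T in RR' eT; clearbody C R.
have nzR : row i0 R != 0.
  apply/eqP=> R0; have := congr1 (row i0) RR'; rewrite row_mul R0 mul0mx row1.
  by move/rowP/(_ i0)/eqP; rewrite !mxE !eqxx eq_sym oner_eq0.
have [X XS eX] := orbit_full (row i1 C') nzR.
pose M := R *m X *m C.
have rowM : row i0 M = delta_mx 0 i1.
  by rewrite /M !row_mul eX -row_mul C'C row1.
have [l /eigenvalueP[u uM nzu]] : exists l, eigenvalue M l.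
  have : size (char_poly M) != 1 by rewrite size_char_poly -(prednK rT0).
  by case/closed_rootP=> l rl; exists l; rewrite eigenvalue_root_char.
pose T' := T *m X *m T - l *: T.
have eT' : T' = C *m (M - l%:M) *m R.
  by rewrite mulmxBr mulmxBl mul_mx_scalar -scalemxAl /M !mulmxA eT -[_ *m C *m
    R]mulmxA eT.
exists T'; split.
- by rewrite /T' memvB ?memvZ // !SM.
- apply/eqP=> T'0; have : C' *m T' *m R' = 0 by rewrite T'0 mulmx0 mul0mx.
  rewrite eT' !mulmxA C'C mul1mx -mulmxA RR' mulmx1 => /(congr1 (row i0)).
  move/rowP/(_ i1)/eqP; rewrite linearB /= rowM !mxE !eqxx /= subr0.
  by rewrite oner_eq0.
rewrite eT'; apply: leq_ltn_trans (mxrankM_maxl _ _) _.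
apply: leq_ltn_trans (mxrankM_maxr _ _) _.
rewrite ltn_neqAle rank_leq_row andbT; apply/negP=> /row_freeP[N MN].
move/negP: nzu; apply; apply/eqP.
by rewrite -[u]mulmx1 -MN mulmxA mulmxBr uM mul_mx_scalar subrr mul0mx.
Qed.

Lemma rank_one : (0 < n)%N -> exists2 T, T \in S & \rank T = 1%N.
Proof.
move=> n0; suff H r : forall T, T \in S -> T != 0 -> (\rank T <= r)%N -> exists2 T,
  T \in S & \rank T = 1%N.
  apply: (H _ 1%:M S1) (leqnn _).
  by rewrite -mxrank_eq0 mxrank1 -lt0n.
elim: r => [|r IHr] T TS nzT rT; first by rewrite -mxrank_eq0 -leqn0 rT in nzT.
have [r1|r1|r1] := ltngtP (\rank T) 1.
- by rewrite -mxrank_eq0 -leqn0 -ltnS r1 in nzT.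
- have [T' [T'S nzT' rT']] := rank_drop TS r1.
  by apply: (IHr T') => //; rewrite -ltnS (leq_trans rT').
by exists T.
Qed.

(** One element c r of rank one is enough: r S is the space of all rows, S c spans all columns, so S
    contains every product of a column by a row, in particular the matrix units. *)
Theorem Burnside_irr : S = fullv.
Proof.
have [n0|n0] := posnP n.
  apply/eqP; rewrite eqEsubv subvf; apply/subvP=> X _.
  suff -> : X = 0 by apply: mem0v.
  apply/matrixP=> i; have := ltn_ord i; by rewrite [X in (_ < X)%N]n0.
have [T TS rT] := rank_one n0.
have nzT : T != 0 by rewrite -mxrank_eq0 rT.
have [c [r eT]] : exists c : 'cV_n, exists r : 'rV_n, T = c *m r.
  have := mulmx_base T; move: (col_base T) (row_base T); rewrite rT => c r <-.
  by exists c, r.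
have nzr : r != 0 by apply: contraNneq nzT => r0; rewrite eT r0 mulmx0.
have nzc : c != 0 by apply: contraNneq nzT => c0; rewrite eT c0 mul0mx.
have cS w : c *m w \in S.
  by have [X XS <-] := orbit_full w nzr; rewrite mulmxA -eT SM.
pose V := \matrix_(i < \dim S) (b`_i *m c)^T.
(* A nonzero row v annihilating S c would satisfy v S = everything, forcing c = 0. *)
have fV : row_full V.
  rewrite -cokermx_eq0; apply/eqP/matrixP=> i j; rewrite mxE.
  pose v := (col j (cokermx V))^T.
  suff /eqP : v = 0.
    by rewrite -trmx_eq0 trmxK => /eqP/colP/(_ i); rewrite !mxE.
  apply: contraNeq nzc => nzv.
  have vX X : X \in S -> v *m X *m c = 0.
    move=> XS; rewrite (coord_vbasis XS) mulmx_sumr mulmx_suml big1 // => l _.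
    rewrite -scalemxAr -scalemxAl; apply/eqP; rewrite scaler_eq0; apply/orP; right.
    rewrite -trmx_eq0 -mulmxA trmx_mul trmxK; apply/eqP.
    have /(congr1 (row l)) : V *m col j (cokermx V) = 0 by rewrite colE mulmxA
      mulmx_coker mul0mx.
    by rewrite row_mul rowK linear0.
  apply/eqP/colP=> l; have [X XS eX] := orbit_full (delta_mx 0 l) nzv.
  by have := vX X XS; rewrite eX -rowE => /rowP/(_ 0); rewrite !mxE.
have allS (u : 'cV_n) w : u *m w \in S.
  have /submxP[d ed] : (u^T <= V)%MS by rewrite submx_full.
  have -> : u = (\sum_i d 0 i *: b`_i) *m c.
    apply: trmx_inj; rewrite ed mulmx_sum_row mulmx_suml linear_sum.
    by apply: eq_bigr => i _; rewrite rowK -scalemxAl linearZ.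
  rewrite -mulmxA SM //; apply: memv_suml => i _; rewrite memvZ //.
apply/eqP; rewrite eqEsubv subvf; apply/subvP=> X _.
rewrite [X]matrix_sum_delta; apply: memv_suml => i _; apply: memv_suml => j _.
by rewrite memvZ // -(mul_delta_mx (0 : 'I_1)) allS.
Qed.
End Burnside.

Section Rho.
Variables (k : fieldType) (gT : finGroupType) (n : nat) (E : gT -> 'M[k]_n).
Definition rho (al : galg k gT) : 'M[k]_n := \sum_a al a *: E a.

Fact rho_linear : linear rho.
Proof.
move=> c x y; rewrite /rho scaler_sumr -big_split; apply: eq_bigr => g _.
by rewrite galg_addE galg_scaleE scalerDl scalerA.
Qed.
HB.instance Definition _ := GRing.isSemilinear.Build k (galg k gT) 'M[k]_n _ rho
  (GRing.semilinear_linear rho_linear).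

Lemma rho_gdelta a : rho (gdelta k a) = E a.
Proof.
rewrite /rho (bigD1 a) //= gdeltaE eqxx scale1r big1 ?addr0 // => h nh.
by rewrite gdeltaE (negPf nh) scale0r.
Qed.
End Rho.

(** * Representations of the dual algebra B *)

Section TwistRep.
Variables (k : fieldType) (gT : finGroupType).
Variable J : galg k (gT * gT)%type.

(* A representation of the dual algebra B, given by the images E g of the dual basis. *)
Definition is_rep n (E : gT -> 'M[k]_n) : Prop :=
  (forall a b, E a *m E b = \sum_g J (g^-1 * a, g^-1 * b)%g *: E g) /\
  \sum_g E g = 1%:M.

(** Left translation is an automorphism of the coalgebra x |-> Delta(x) J, so its dual may be
    composed with any representation of B. *)
Lemma rep_translate n (E : gT -> 'M[k]_n) h : is_rep E -> is_rep (fun g => E (h * g)%g).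
Proof.
case=> EM E1; split=> [a b|]; last by rewrite -E1 [RHS](reindex_inj (mulgI h)).
rewrite EM (reindex_inj (mulgI h)); apply: eq_bigr => g _.
by rewrite !invMg -!mulgA !mulKg.
Qed.

(* The product of B, a functional being given by its values on the basis G of kG. *)
Definition bmul (al be : galg k gT) : galg k gT :=
  [ffun g => \sum_a \sum_b J (g^-1 * a, g^-1 * b)%g * (al a * be b)].

Lemma rho_bmul n (E : gT -> 'M[k]_n) al be : is_rep E ->
  rho E (bmul al be) = rho E al *m rho E be.
Proof.
case=> EM _; rewrite /rho mulmx_suml.
transitivity (\sum_g \sum_a \sum_b (J (g^-1 * a, g^-1 * b)%g * (al a * be b)) *: E g).
  apply: eq_bigr => g _; rewrite ffunE scaler_suml; apply: eq_bigr => a _.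
  by rewrite scaler_suml.
rewrite exchange_big; apply: eq_bigr => a _ /=; rewrite mulmx_sumr exchange_big.
apply: eq_bigr => b _ /=; rewrite -scalemxAl -scalemxAr scalerA EM scaler_sumr.
by apply: eq_bigr => g _; rewrite scalerA mulrC.
Qed.

Definition bone : galg k gT := [ffun => 1].

Lemma rho_bone n (E : gT -> 'M[k]_n) : is_rep E -> rho E bone = 1%:M.
Proof. by case=> _ <-; apply: eq_bigr => a _; rewrite ffunE scale1r. Qed.

(** Associativity of B on the dual basis, compared at the coefficient of 1; it is the twist equation
    read at ((x, a), b). *)
Lemma twist_eq_at : is_twist J -> forall x a b,
  \sum_z J (z, b) * J (z^-1 * x, z^-1 * a)%g = \sum_g J (x, g) * J (g^-1 * a, g^-1
    * b)%g.
Proof.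
case=> _ [+ _] x a b => /ffunP/(_ ((x, a), b)).
rewrite push_d12E push_m12E push_d23E push_m23E => e.
have {e} : (push d12 J * push m12 J) ((x, a), b) = (push d23 J * push m23 J) ((x,
  a), b) := e.
have sumd (f : gT * gT -> (gT * gT) * gT) (K : galg k ((gT * gT) * gT)%type) q :
  (push f J * K) q = \sum_p J p * K ((f p)^-1 * q)%g.
  rewrite /push mulr_suml galg_sumE; apply: eq_bigr => p _.
  by rewrite -scalerAl galg_scaleE gdelta_mulE.
rewrite !sumd => e.
transitivity (\sum_p J p * push m12 J ((d12 p)^-1 * (x, a, b))%g); last rewrite e.
  rewrite [RHS](eq_bigr (fun p => J (p.1, p.2) * push m12 J ((d12 (p.1, p.2))^-1 *
    (x, a, b))%g)) => [|[]//].
  rewrite -(pair_big xpredT xpredT (fun p1 p2 => J (p1, p2) * push m12 J ((d12 (p1,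
    p2))^-1 * (x, a, b))%g)) /=.
  (* Only c = b makes the third leg trivial, as the support of J (x) 1 requires. *)
  apply: eq_bigr => z _; rewrite (bigD1 b) //= big1 ?addr0 => [|c nc].
    have -> : ((d12 (z, b))^-1 * (x, a, b) = m12 (z^-1 * x, z^-1 * a))%g.
      by congr (_, _); rewrite /= ; exact: mulVg.
    by rewrite push_injE // => ? ? [].
  rewrite push_out ?mulr0 // => d; apply: contraNneq nc => -[_ /esym/eqP].
  by rewrite -eq_mulVg1.
rewrite (eq_bigr (fun p => J (p.1, p.2) * push m23 J ((d23 (p.1, p.2))^-1 * (x, a,
  b))%g)) => [|[]//].
rewrite -(pair_big xpredT xpredT (fun p1 p2 => J (p1, p2) * push m23 J ((d23 (p1,
  p2))^-1 * (x, a, b))%g)) /=.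
rewrite (bigD1 x) //= [X in _ + X]big1 ?addr0 => [|c nc].
  apply: eq_bigr => g _.
  have -> : ((d23 (x, g))^-1 * (x, a, b) = m23 (g^-1 * a, g^-1 * b))%g.
    by congr ((_, _), _); exact: mulVg.
  by rewrite push_injE // => -[? ?] [? ?] [-> ->].
apply: big1 => g _; rewrite push_out ?mulr0 // => -[d1 d2];
  apply: contraNneq nc => -[/eqP].
by rewrite eq_sym -eq_mulVg1.
Qed.

(** The entry (x, y) of the matrix of b is the coefficient of d_y in the product d_x d_b: this is
    right multiplication on B, acting on row vectors. Multiplicativity is [twist_eq_at], and the
    unit law is the counit condition on the second leg. *)
Lemma regular_rep : is_twist J -> exists E : gT -> 'M[k]_#|gT|, is_rep E.
Proof.
move=> tJ; exists (fun b => \matrix_(x, y)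
  J ((enum_val y)^-1 * enum_val x, (enum_val y)^-1 * b)%g); split=> [a b|];
    apply/matrixP=> x y.
  rewrite mxE summxE [RHS](reindex_inj (mulgI (enum_val y))).
  rewrite [RHS](eq_bigr (fun g => J ((enum_val y)^-1 * enum_val x, g)%g *
    J (g^-1 * ((enum_val y)^-1 * a), g^-1 * ((enum_val y)^-1 * b))%g)) => [|g _];
      last first.
    by rewrite !mxE mulrC invMg mulKg !mulgA.
  rewrite -twist_eq_at // [RHS](reindex_inj (mulgI (enum_val y)^-1%g)).
  rewrite [LHS](reindex (@enum_rank gT)) /=; last exact: onW_bij (@enum_rank_bij gT).
  apply: eq_bigr => g _.
  by rewrite !mxE enum_rankK mulrC invMg invgK -!mulgA !mulKVg.
have /is_twistP[_ _ _ c2] := tJ.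
rewrite summxE (eq_bigr (fun b => J ((enum_val y)^-1 * enum_val x, (enum_val y)^-1
  * b)%g)) => [|b _]; last first.
  by rewrite mxE.
rewrite (reindex_inj (mulgI (enum_val y))) /= (eq_bigr _ (fun b _ => congr1 (fun c
  => J (_, c)) (mulKg _ b))).
rewrite -push_fstE c2 galg_oneE mxE -eq_mulVg1 (inj_eq enum_val_inj) eq_sym.
by [].
Qed.

Lemma sub_rep n (E : gT -> 'M[k]_n) m (U : 'M[k]_(m, n)) : is_rep E ->
  (forall X, X \in limg (linfun (rho E)) -> (U *m X <= U)%MS) ->
  exists E' : gT -> 'M[k]_(\rank U), is_rep E'.
Proof.
move=> [EM E1] inv; set R := row_base U; have fR : row_free R := row_base_free U.
have RE a : (R *m E a <= R)%MS.
  rewrite (eqmxMr _ (eq_row_base U)) eq_row_base inv //.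
  by rewrite -(rho_gdelta E) -[rho _ _](lfunE (rho E)) memv_img ?memvf.
exists (fun a => R *m E a *m pinvmx R); have K a := mulmxKpV (RE a).
split=> [a b|]; apply: (row_free_inj fR).
  rewrite -(mulmxA (R *m E a *m _)) K (mulmxA (R *m E a *m _)) K -mulmxA EM.
  rewrite mulmx_sumr mulmx_suml; apply: eq_bigr => g _.
  by rewrite -scalemxAl K scalemxAr.
rewrite mulmx_suml (eq_bigr _ (fun a _ => K a)) -mulmx_sumr E1 mulmx1 mul1mx.
by [].
Qed.

End TwistRep.

(** Descent on the dimension from the regular representation, excluded middle deciding whether a
    proper invariant subspace exists. When none does, Burnside's theorem turns irreducibility into
    surjectivity onto the matrix algebra, the form used from here on. *)
Lemma irr_rep (k : closedFieldType) (gT : finGroupType) (J : galg k (gT * gT)%type)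
  : is_twist J ->
  exists n, exists E : gT -> 'M[k]_n,
    [/\ (0 < n)%N, is_rep J E & limg (linfun (rho E)) = fullv].
Proof.
move=> tJ; suff H n : forall m, (0 < m <= n)%N -> forall E : gT -> 'M[k]_m, is_rep
  J E ->
    exists n, exists E : gT -> 'M[k]_n,
    [/\ (0 < n)%N, is_rep J E & limg (linfun (rho E)) = fullv].
  have [E rE] := regular_rep tJ; apply: (H #|gT| #|gT| _ E rE).
  by rewrite leqnn -cardsT cardG_gt0.
elim: n => [|n IHn] m; first by case: m.
case/andP=> m0 mn E rE.
have [[d [U [d1 d2 inv]]]|nU] := Classical_Prop.classic (exists d, exists U :
  'M[k]_(d, m),
  [/\ U <> 0, ~~ row_full U & forall X, X \in limg (linfun (rho E)) -> (U *m X <=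
    U)%MS]).
  have [E' rE'] := sub_rep rE inv; apply: (IHn _ _ E' rE').
  rewrite lt0n mxrank_eq0; apply/andP; split; first by apply/eqP.
  by rewrite -ltnS (leq_trans _ mn) // ltn_neqAle d2 rank_leq_col.
exists m, E; split=> //; apply: Burnside_irr.
- move=> _ _ /memv_imgP[al _ ->] /memv_imgP[be _ ->].
  by rewrite !lfunE /= -(rho_bmul al be rE) -[rho _ _](lfunE (rho E)) memv_img ?memvf.
- by rewrite -(rho_bone rE) -[rho _ _](lfunE (rho E)) memv_img ?memvf.
move=> d U inv; have [->|nz] := eqVneq U 0; first by left.
right; apply: contra_notT nU => nf; exists d, U; split=> //.
exact/eqP.
Qed.

Section Trace.
Variables (k : fieldType) (n : nat).

Lemma trace_delta (Y : 'M[k]_n) i j : \tr (Y *m delta_mx i j) = Y j i.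
Proof.
rewrite /mxtrace (bigD1 j) //= big1 ?addr0 => [|l nl].
  rewrite mxE (bigD1 i) //= big1 ?addr0 => [|l nl]; first by rewrite mxE !eqxx mulr1.
  by rewrite mxE (negPf nl) mulr0.
rewrite mxE big1 // => m _; rewrite mxE (negPf nl) andbF mulr0.
by [].
Qed.

Lemma trace_form (l : {linear 'M[k]_n -> k^o}) : exists Y, forall X, l X = \tr (Y *m X).
Proof.
exists (\matrix_(j, i) l (delta_mx i j)) => X.
rewrite {1}[X]matrix_sum_delta [X in \tr (_ *m X)]matrix_sum_delta.
rewrite mulmx_sumr !linear_sum; apply: eq_bigr => i _.
rewrite mulmx_sumr !linear_sum; apply: eq_bigr => j _.
by rewrite -scalemxAr !linearZ /= trace_delta mxE.
Qed.
Lemma delta_sandwich (X : 'M[k]_n) i j (l : 'I_n) :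
  delta_mx l i *m X *m delta_mx j l = X i j *: delta_mx l l :> 'M_n.
Proof.
rewrite -(mul_delta_mx (0 : 'I_1) l i) -(mul_delta_mx (0 : 'I_1) j l) !mulmxA.
rewrite -(mulmxA _ X) -colE -(mulmxA _ (delta_mx 0 i)) -rowE.
rewrite (_ : row i (col j X) = (X i j)%:M) ?mul_mx_scalar -?scalemxAl ?mul_delta_mx //.
by apply/rowP=> q; rewrite !ord1 !mxE eqxx.
Qed.
End Trace.

(** * Matrix coefficients and their translates *)

Section Translate.
Variables (k : fieldType) (gT : finGroupType).
Definition ltrans (g : gT) : 'End(galg k gT) := amull (gdelta k g).

Lemma ltransE g x : ltrans g x = gdelta k g * x. Proof. by rewrite lfunE. Qed.

Lemma ltransM g h (U : {vspace galg k gT}) :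
  (ltrans g @: (ltrans h @: U))%VS = (ltrans (g * h) @: U)%VS.
Proof.
rewrite -limg_comp; congr (lfun_img _ _); apply/lfunP=> x.
by rewrite comp_lfunE !ltransE mulrA gdeltaM.
Qed.

Lemma ltrans1 (U : {vspace galg k gT}) : (ltrans 1 @: U)%VS = U.
Proof.
rewrite -[RHS]lim1g; congr (lfun_img _ _); apply/lfunP=> x.
by rewrite id_lfunE !ltransE gdelta1 mul1r.
Qed.

Lemma dim_ltrans g (U : {vspace galg k gT}) : \dim (ltrans g @: U) = \dim U.
Proof.
apply: limg_dim_eq; apply/eqP; rewrite -subv0; apply/subvP=> x.
rewrite memv_cap memv_ker memv0 ltransE => /andP[_ /eqP e].
by rewrite -[x]mul1r -gdelta1 -(mulVg g) -gdeltaM -mulrA e mulr0.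
Qed.

Lemma mem_ltrans g (U : {vspace galg k gT}) x : (x \in ltrans g @: U)%VS = (gdelta
  k g^-1 * x \in U).
Proof.
apply/idP/idP=> [/memv_imgP[y yU ->]|xU].
  by rewrite ltransE mulrA gdeltaM mulVg gdelta1 mul1r.
have -> : x = ltrans g (gdelta k g^-1 * x) by rewrite ltransE mulrA gdeltaM mulgV
  gdelta1 mul1r.
exact: memv_img.
Qed.
End Translate.

Section CoefFun.
Variables (k : fieldType) (gT : finGroupType) (n : nat) (E : gT -> 'M[k]_n).

(** Matrix coefficients of E are functionals on B, hence elements of kG. Indexing them by Y through
    the trace form presents the simple subcoalgebra D as a linear image of the matrix algebra. *)
Definition coef (Y : 'M[k]_n) : galg k gT := [ffun a => \tr (Y *m E a)].

Fact coef_linear : linear coef.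
Proof.
move=> c X Y; apply/galgP=> a; rewrite galg_addE galg_scaleE [LHS]ffunE.
by rewrite [coef X a]ffunE [coef Y a]ffunE mulmxDl linearD /= -scalemxAl linearZ.
Qed.
HB.instance Definition _ := GRing.isSemilinear.Build k 'M[k]_n (galg k gT) _ coef
  (GRing.semilinear_linear coef_linear).

Lemma coef_pair Y (al : galg k gT) : \sum_a al a * coef Y a = \tr (Y *m rho E al).
Proof.
rewrite /rho mulmx_sumr linear_sum; apply: eq_bigr => a _.
by rewrite ffunE -scalemxAr linearZ.
Qed.

End CoefFun.

Section Coeff.
Variables (k : fieldType) (gT : finGroupType).
Variables (J : galg k (gT * gT)%type) (n : nat) (E : gT -> 'M[k]_n).
Hypotheses (n0 : (0 < n)%N) (rE : is_rep J E) (fE : limg (linfun (rho E)) = fullv).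

Local Notation coef := (coef E).

Lemma rho_surj X : exists al, rho E al = X.
Proof.
have : X \in limg (linfun (rho E)) by rewrite fE memvf.
by case/memv_imgP=> al _ ->; exists al; rewrite lfunE.
Qed.

Definition coefs : {vspace galg k gT} := limg (linfun coef).

Lemma coefsP x : reflect (exists Y, x = coef Y) (x \in coefs).
Proof.
apply: (iffP memv_imgP) => [[Y _ ->]|[Y ->]]; first by exists Y; rewrite lfunE.
by exists Y; rewrite ?memvf // lfunE.
Qed.

Lemma coef_inj : injective coef.
Proof.
move=> X Y eXY; apply/matrixP=> i j; have [al ea] := rho_surj (delta_mx j i).
by rewrite -(trace_delta X) -(trace_delta Y) -ea -!coef_pair eXY.
Qed.

Lemma dim_coefs : \dim coefs = (n * n)%N.
Proof.
rewrite /coefs limg_dim_eq ?dimvf //.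
apply/eqP; rewrite capfv; apply/lker0P=> X Y; rewrite !lfunE; exact: coef_inj.
Qed.

Definition stab : {set gT} := [set g | ltrans k g @: coefs == coefs]%VS.

Fact stab_group_set : group_set stab.
Proof.
apply/group_setP; split=> [|g h]; first by rewrite inE ltrans1.
by rewrite !inE -ltransM => /eqP sg /eqP->; rewrite sg.
Qed.
Canonical stab_group := Group stab_group_set.

Lemma coef_tr g Y : gdelta k g^-1 * coef Y = [ffun a => \tr (Y *m E (g * a)%g)] :>
  galg k gT.
Proof. by apply/galgP=> a; rewrite gdelta_mulE !ffunE invgK. Qed.

(** The kernel of the translated representation is a two-sided ideal not contained in the kernel of
    E, so its image under E is a nonzero ideal of a matrix algebra and contains 1. *)
Lemma separate1 g : g \notin stab ->
  exists al, rho E al = 1%:M /\ rho (fun a => E (g * a)%g) al = 0.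
Proof.
move=> ng; have rE' := rep_translate g rE.
pose f := linfun (rho E); pose f' := linfun (rho (fun a => E (g * a)%g)).
(* If the kernels were nested, each functional tr(Y E) would factor through the translate, with
   [f'^-1] choosing preimages; D would then lie in a translate of itself and equal it by
   dimension. *)
have [al al0 nal] : exists2 al, al \in lker f' & al \notin lker f.
  apply/subvPn; apply: contra ng => le;
    rewrite -groupV inE eq_sym eqEdim dim_ltrans leqnn andbT.
  apply/subvP=> _ /coefsP[Y ->]; rewrite mem_ltrans invgK.
  have ef al : f al = f (f'^-1%VF (f' al)).
    apply/eqP; rewrite -subr_eq0 -linearB -memv_ker (subvP le) // memv_ker linearB /=.
    by rewrite limg_lfunVK ?subrr // memv_img ?memvf.
  pose l X : k^o := \tr (Y *m f (f'^-1%VF X)).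
  have lin_l : linear l.
    move=> c X X'; rewrite /l (linearP (f'^-1)%VF) (linearP f) mulmxDr linearD /=
      -scalemxAr linearZ.
    by [].
  pose hl := GRing.isSemilinear.Build k 'M[k]_n k^o _ l (GRing.semilinear_linear lin_l).
  pose ll : {linear 'M[k]_n -> k^o} := HB.pack l hl.
  have [Y' eY'] := trace_form ll.
  apply/coefsP; exists Y'; apply/galgP=> a; rewrite gdelta_mulE !ffunE.
  have := eY' (E a); rewrite /= /l => <-.
  have := ef (gdelta k (g^-1 * a)%g);
    rewrite ![f (gdelta _ _)]lfunE [f' _]lfunE /= !rho_gdelta mulKVg.
  by move=> ->.
have al0' : rho (fun a => E (g * a)%g) al = 0.
  by move: al0; rewrite memv_ker lfunE => /eqP.
have [i [j nij]] : exists i, exists j, rho E al i j != 0.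
  by apply/matrix0Pn; move: nal; rewrite memv_ker lfunE.
have /fin_all_exists[xi exi] l := rho_surj (delta_mx l i).
have /fin_all_exists[eta eeta] l := rho_surj (delta_mx j l).
(* Multiplying by lifts of matrix units moves the nonzero entry (i, j) to each diagonal position l;
   the sum is the identity matrix. *)
exists (\sum_l (rho E al i j)^-1 *: bmul J (bmul J (xi l) al) (eta l)).
rewrite !linear_sum /= mx1_sum_delta; split; [apply: eq_bigr|apply: big1] => l _.
  by rewrite linearZ /= !rho_bmul // exi eeta delta_sandwich scalerA mulVf ?scale1r.
by rewrite linearZ /= !rho_bmul // al0' mulmx0 mul0mx scaler0.
Qed.

(** The product over G of the elements from [separate1] stays 1 under E and acquires a zero factor
    on every other translate. *)
Lemma separate : exists al, rho E al = 1%:M /\ forall g, g \notin stab -> rho (fun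
  a => E (g * a)%g) al = 0.
Proof.
suff H (s : seq gT) : exists al, rho E al = 1%:M /\ forall g, g \in s -> g \notin
  stab -> rho (fun a => E (g * a)%g) al = 0.
  have [al [e1 e2]] := H (enum gT); exists al; split=> // g; apply: e2.
  by rewrite mem_enum.
elim: s => [|h s [al [e1 e2]]]; first by exists (bone k gT); rewrite (rho_bone rE).
have [hS|nh] := boolP (h \in stab).
  by exists al; split=> // g; rewrite inE => /predU1P[->|/e2//]; rewrite hS.
have [be [transport1 map_pair]] := separate1 nh.
exists (bmul J be al); split; first by rewrite (rho_bmul be al rE) e1 transport1 mulmx1.
move=> g gs ng; rewrite (rho_bmul be al (rep_translate g rE)).
by move: gs; rewrite inE => /predU1P[->|/e2->//]; rewrite ?map_pair ?mul0mx ?mulmx0.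
Qed.

(** A separating element kills all summands but one, and the surviving matrix Y is then orthogonal
    to every matrix for the trace form. *)
Lemma coefs_direct (I : finType) (P : pred I) (h : I -> gT) (us : I -> galg k gT) i0 :
  P i0 -> (forall i, P i -> us i \in ltrans k (h i) @: coefs)%VS ->
  (forall i, P i -> i != i0 -> ((h i0)^-1 * h i)%g \notin stab) ->
  \sum_(i | P i) us i = 0 -> us i0 = 0.
Proof.
move=> Pi0 us_in dis sum0; have [be [e1 e2]] := separate.
suff H Y : coef Y = gdelta k (h i0)^-1 * us i0 -> Y = 0.
  have := us_in _ Pi0; rewrite mem_ltrans => /coefsP[Y eY].
  have Y0 := H Y (esym eY).
  rewrite -[us i0]mul1r -gdelta1 -(mulgV (h i0)) -gdeltaM -mulrA eY Y0.
  by rewrite (linear0 coef) mulr0.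
move=> eY; suff H al : \tr (Y *m rho E al) = 0.
  apply/matrixP=> i j; have [al ea] := rho_surj (delta_mx j i).
  by rewrite mxE -trace_delta -ea H.
(* After translating the relation by the inverse of [h i0], pair it with al times the separating
   element, al being arbitrary. *)
have := congr1 (fun x : galg k gT => \sum_a bmul J al be a * (gdelta k (h i0)^-1 *
  x) a) sum0.
rewrite [RHS]big1 => [|a _];
  last by rewrite (mulr0 (gdelta k (h i0)^-1)) [X in _ * X]ffunE mulr0.
rewrite /=.
rewrite (eq_bigr (fun a => \sum_(i | P i) bmul J al be a * (gdelta k (h i0)^-1 * us
  i) a)) => [|a _]; last first.
  by rewrite mulr_sumr galg_sumE mulr_sumr.
rewrite exchange_big /= (bigD1 i0) //= -eY coef_pair (rho_bmul al be rE) e1 mulmx1.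
rewrite big1 ?addr0 // => i /andP[Pi ni].
have := us_in _ Pi; rewrite mem_ltrans => /coefsP[Z eZ].
have -> : gdelta k (h i0)^-1 * us i = [ffun a => \tr (Z *m E (((h i)^-1 * h i0) *
  a)%g)] :> galg k gT.
  rewrite -coef_tr -eZ mulrA gdeltaM; congr (gdelta k _ * _).
  by rewrite invMg invgK mulgK.
rewrite [LHS](coef_pair (fun a => E ((h i)^-1 * h i0 * a)%g)) (rho_bmul al be
  (rep_translate _ rE)).
rewrite e2 ?mulmx0 ?mulmx0 ?linear0 // -[_ \in _]groupV /= invMg invgK dis //.
Qed.

Local Notation d := (n * n)%N.
Local Notation D := coefs.

Definition tsq : {vspace galg k (gT * gT)%type} :=
  <<[seq otimes u v | u <- vbasis D, v <- vbasis D]>>%VS.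

Lemma dim_tsq : (\dim tsq <= d * d)%N.
Proof. by apply: leq_trans (dim_span _) _;
  rewrite size_allpairs !size_tuple dim_coefs. Qed.

Lemma mem_tsq u v : u \in D -> v \in D -> otimes u v \in tsq.
Proof.
move=> uD vD; rewrite (coord_vbasis uD) (coord_vbasis vD) otimes_push !linear_sum
  mulr_suml.
apply: memv_suml => i _; rewrite mulr_sumr; apply: memv_suml => j _.
rewrite !linearZ /= -scalerAl -scalerAr !memvZ // -otimes_push memv_span //.
by apply/allpairsP; exists ((vbasis D)`_i, (vbasis D)`_j); split=> //=;
  rewrite mem_nth ?size_tuple.
Qed.

(** Multiplicativity of E says that Delta(x) J takes the value tr(Y E(a) E(b)) at (a, b); inserting
    matrix units between the factors splits it into products of coefficients. *)
Lemma comul_tsq x : x \in D -> push diag x * J \in tsq.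
Proof.
move=> /coefsP[Y ->].
have -> : push diag (coef Y) * J = \sum_i \sum_l otimes (coef (delta_mx l i)) (coef
  (Y *m delta_mx i l)).
  apply/galgP=> -[a b]; rewrite /push mulr_suml galg_sumE.
  transitivity (\tr (Y *m (E a *m E b))).
    case: rE => -> _; rewrite mulmx_sumr linear_sum; apply: eq_bigr => g _.
    rewrite -scalerAl galg_scaleE gdelta_mulE ffunE -scalemxAr linearZ /= mulrC.
    by [].
  rewrite mulmxA mxtrace_mulC mulmxA mxtrace_mulC.
  rewrite galg_sumE {1}/mxtrace; apply: eq_bigr => i _.
  rewrite mxE galg_sumE; apply: eq_bigr => l _.
  rewrite otimesE !ffunE /= mxtrace_mulC trace_delta; congr (_ * _).
  by rewrite -mulmxA mxtrace_mulC -mulmxA mxtrace_mulC trace_delta.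
apply: memv_suml => i _; apply: memv_suml => l _.
by apply: mem_tsq; apply/coefsP; eexists.
Qed.

Lemma stab_mem h x : h \in stab -> x \in D -> gdelta k h * x \in D.
Proof. by rewrite inE -ltransE => /eqP{2}<- xD; rewrite memv_img. Qed.

Lemma tsq_stab h t : h \in stab -> t \in tsq -> gdelta k (h, 1%g) * t \in tsq.
Proof.
move=> hS; rewrite -ltransE => tT.
have : ltrans k (h, 1%g) t \in (ltrans k (h, 1%g) @: tsq)%VS by apply: memv_img.
apply/subvP; rewrite /tsq limg_span;
  apply/span_subvP=> _ /mapP[_ /allpairsP[[u v] [/= uD vD ->]] ->].
rewrite ltransE -otimes_gdelta otimesM gdelta1 mul1r mem_tsq ?stab_mem //;
  exact: vbasis_mem.
Qed.

(* (kH (x) 1) Delta(D) J has dimension |H| d and is contained in D (x) D. *)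
Lemma card_stab_le J' : J * J' = 1 -> (#|stab| <= d)%N.
Proof.
move=> JJ'.
pose b := vbasis D; pose h (i : 'I_#|stab|) := enum_val i.
pose Phi (M : 'M[k]_(#|stab|, \dim D)) : galg k (gT * gT)%type :=
  \sum_i \sum_j M i j *: (gdelta k (h i, 1%g) * (push diag b`_j * J)).
have linPhi : linear Phi.
  move=> c X Y; rewrite /Phi scaler_sumr -big_split; apply: eq_bigr => i _.
  rewrite scaler_sumr -big_split; apply: eq_bigr => j _.
  by rewrite !mxE scalerDl scalerA.
pose hP := GRing.isSemilinear.Build k 'M[k]_(_, _) _ _ Phi (GRing.semilinear_linear
  linPhi).
pose PhiL : {linear 'M[k]_(#|stab|, \dim D) -> galg k (gT * gT)%type} := HB.pack Phi hP.
have le : (limg (linfun PhiL) <= tsq)%VS.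
  apply/subvP=> _ /memv_imgP[M _ ->]; rewrite lfunE /= /Phi.
  apply: memv_suml => i _; apply: memv_suml => j _;
    rewrite memvZ // tsq_stab ?enum_valP //.
  by rewrite comul_tsq // vbasis_mem // mem_nth ?size_tuple.
have := leq_trans (dimvS le) dim_tsq; rewrite limg_dim_eq.
  rewrite dimvf /dim /= dim_coefs leq_pmul2r // muln_gt0 n0 //.
apply/eqP; rewrite -subv0; apply/subvP=> M;
  rewrite memv_cap memv_ker memv0 lfunE /= => /andP[_ /eqP M0].
apply/eqP/matrixP=> i j; rewrite mxE.
have /freeP fb : free b := basis_free (vbasisP D).
apply: (fb (fun j => M i j)) j; apply/galgP=> y; rewrite galg_sumE [RHS]ffunE.
have /galgP/(_ (h i * y, y)%g) : Phi M * J' = 0 by rewrite M0 mul0r.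
rewrite [in X in _ = X -> _]ffunE => PhiM; rewrite -[RHS]PhiM.
rewrite /Phi mulr_suml galg_sumE (bigD1 i) //= [X in _ + X]big1 ?addr0 => [|i' ni].
  rewrite mulr_suml galg_sumE. refine (eq_bigr _ _) => j0 _.
  rewrite -scalerAl !galg_scaleE -!mulrA JJ' mulr1 gdelta_mulE.
  have -> : ((h i, 1) ^-1 * (h i * y, y) = diag y)%g.
    by congr (_, _); rewrite /= ?mulKg // ;
      exact: (etrans (congr1 (fun z => z * y)%g (@invg1 gT)) (mul1g y)).
  by rewrite push_injE // => ? ? [].
rewrite mulr_suml galg_sumE big1 // => j _.
rewrite -scalerAl !galg_scaleE -!mulrA JJ' mulr1 gdelta_mulE.
rewrite push_out ?mulr0 // => z; apply: contraNneq ni => -[e1 e2].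
apply/eqP/enum_val_inj/(mulIg y); rewrite -[RHS](mulKVg (h i')) -[(_^-1 * _)%g]e1 e2.
by congr (_ * _)%g; exact: (esym (etrans (congr1 (fun z => z * y)%g (@invg1 gT))
  (mul1g y))).
Qed.

Lemma repr_lcosets A : A \in lcosets stab [set: gT] -> (repr A *: stab)%g = A.
Proof.
case/lcosetsP=> x _ ->; apply/(lcoset_eqP (G := [group of stab])).
exact: mem_repr (lcoset_refl _ x).
Qed.

Lemma dim_sum_ltrans :
  \dim (\sum_(A in lcosets stab [set: gT]) (ltrans k (repr A) @: D)) = (#|[set: gT]
    : stab|%g * d)%N.
Proof.
have /directvP /= -> : directv (\sum_(A in lcosets stab [set: gT]) (ltrans k (repr
  A) @: D)).
  apply/directv_sum_independent => us usD us0 A PA.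
  apply: (coefs_direct (P := mem (lcosets stab [set: gT])) (h := repr) PA usD _
    us0) => B PB.
  apply: contraNN => sAB.
  rewrite -(repr_lcosets PA) -(repr_lcosets PB); apply/eqP.
  apply/(lcoset_eqP (G := [group of stab])); by rewrite mem_lcoset.
rewrite (eq_bigr (fun=> d)) => [|A _]; last by rewrite dim_ltrans dim_coefs.
by rewrite sum_nat_const card_lcosets.
Qed.

(** Independence of the translates gives [G:H] d <= |G| = [G:H] |H|, which is the inequality
    opposite to [card_stab_le]. *)
Lemma card_stab J' : J * J' = 1 -> #|stab| = d.
Proof.
move=> JJ'; apply/eqP; rewrite eqn_leq (card_stab_le JJ') /=.
rewrite -(@leq_pmul2l #|[set: gT] : stab|%g) ?indexg_gt0 // -dim_sum_ltrans.
apply: leq_trans (dimvS (subvf _)) _; rewrite dim_galg -cardsT.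
by rewrite -(Lagrange (subsetT [group of stab])) mulnC.
Qed.

Lemma sum_tr_full J' : J * J' = 1 ->
  (\sum_(A in lcosets stab [set: gT]) (ltrans k (repr A) @: D))%VS = fullv.
Proof.
move=> JJ'; apply/eqP; rewrite eqEdim subvf dim_sum_ltrans -(card_stab JJ').
by rewrite dim_galg -cardsT -(Lagrange (subsetT [group of stab])) mulnC leqnn.
Qed.

(** The translates of D fill kG and all lie in kG x, so 1 lies in kG x. *)
Lemma cyclic_left_inv J' x : J * J' = 1 -> (forall y, y \in D -> exists z, y = z * x) ->
  exists z, z * x = 1.
Proof.
move=> JJ' gen; have : (1 : galg k gT) \in (\sum_(A in lcosets stab [set: gT])
  (ltrans k (repr A) @: D))%VS.
  by rewrite (sum_tr_full JJ') memvf.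
case/memv_sumP=> us usD e1.
have /fin_all_exists[z ez] A : exists z, A \in lcosets stab [set: gT] -> us A = z * x.
  have [AL|] := boolP (A \in _); last by exists 0.
  have := usD _ AL; rewrite mem_ltrans => /gen[z ez].
  by exists (gdelta k (repr A) * z) => _;
    rewrite -mulrA -ez mulrA gdeltaM mulgV gdelta1 mul1r.
exists (\sum_(A in lcosets stab [set: gT]) z A); rewrite mulr_suml e1.
by apply: eq_bigr => A AL; rewrite ez.
Qed.
End Coeff.

(** * Characters of the stabilizer *)

Section Characters.
Variables (k : closedFieldType) (gT : finGroupType) (H : {group gT}).
Hypotheses (k0 : [pchar k] =i pred0) (abH : abelian H).

Lemma natf_neq0_char0 n : (0 < n)%N -> n%:R != 0 :> k.
Proof. by move: k0 => /pcharf0P k0' n0; rewrite k0' -lt0n. Qed.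

(** In characteristic zero an abelian H has |H| irreducible representations over k, all of degree
    one. Their values are extended by 0 outside H, as [is_char] demands. *)
Lemma chars_exist : exists s : seq (galg k gT),
  [/\ uniq s, size s = #|H| & forall a, a \in s -> is_char H a].
Proof.
pose sH := DecSocleType (regular_repr k H).
have k'H : ([pchar k]^').-group%g H.
  by apply/pgroupP => p _ _; rewrite inE /=; have := k0 p; rewrite !inE => ->.
have splitH : group_splitting_field k H := @group_closure_closed_field k gT H.
have linH := irr_degree_abelian splitH abH (_ : sH).
have cardH : #|sH| = #|H|.
  by rewrite card_irr_pchar //; apply/eqP; rewrite -card_classes_abelian.
have scal (W : sH) h : h \in H -> irr_repr W h = (irr_mode W h)%:M.
  by move=> hH; apply: irr_center_scalar; rewrite ?(center_idP _).
pose chi (W : sH) : galg k gT := [ffun h => if h \in H then irr_mode W h else 0].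
have inj_chi : injective chi.
  move=> V W eqVW; rewrite -(irr_reprK_pchar k'H V) -(irr_reprK_pchar k'H W).
  have eqm h : h \in H -> irr_mode V h = irr_mode W h.
    by move=> hH; have /ffunP/(_ h) := eqVW; rewrite !ffunE hH.
  have sV := scal V; have sW := scal W.
  move: (irr_repr V) (irr_repr W) sV sW eqm; move: (irr_mode V) (irr_mode W) => mV mW.
  rewrite !linH => rV rW sV sW eqm; apply: irr_comp_rsim_pchar => //.
  exists 1%:M; rewrite ?row_free_unit ?unitmx1 // => h hH.
  by rewrite mulmx1 mul1mx sV // sW // eqm.
exists [seq chi W | W <- enum sH]; split.
- by rewrite map_inj_uniq ?enum_uniq.
- by rewrite size_map -cardE.
move=> _ /mapP[W _ ->]; split; first by rewrite ffunE group1 irr_mode1.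
split=> [x y xH yH|x nx]; last by rewrite ffunE (negPf nx).
by rewrite !ffunE groupM // xH yH irr_modeM ?(center_idP _).
Qed.

Lemma char_mulV (a : galg k gT) h : is_char H a -> h \in H -> a h * a h^-1%g = 1.
Proof. by case=> a1 [aM _] hH; rewrite -aM ?groupV // mulgV. Qed.

Lemma char_orth (a b : galg k gT) : is_char H a -> is_char H b ->
  \sum_(h in H) a h * b h^-1%g = (a == b)%:R * #|H|%:R.
Proof.
move=> ca cb; have [<-|nab] := eqVneq a b.
  by rewrite (eq_bigr (fun=> 1)) => [|h hH]; rewrite ?char_mulV // sumr_const mul1r.
have [h0 hH0 nh] : exists2 h, h \in H & a h != b h.
  apply/exists_inP; move: nab; apply: contraR; rewrite negb_exists_in => /forall_inP ab.
  apply/eqP/ffunP=> h; have [hH|nh] := boolP (h \in H).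
    by have := ab h hH; rewrite negbK => /eqP.
  by case: ca cb => [_ [_ ->]] // [_ [_ ->]].
have [a1 [aM _]] := ca; have [b1 [bM _]] := cb.
rewrite mul0r; set S := (X in X = _).
have : a h0 * b h0^-1%g * S = S.
  rewrite {2}/S (reindex_inj (mulgI h0)) mulr_sumr /=.
  apply: eq_big => [h|h hH]; first by rewrite groupMl.
  by rewrite aM // invMg bM ?groupV // mulrACA [b h0^-1%g * _]mulrC.
move/eqP; rewrite -subr_eq0 -{2}[S]mul1r -mulrBl mulf_eq0 subr_eq0 => /orP[/eqP
  ab1|/eqP //].
case/eqP: nh; rewrite -[LHS]mulr1 -(char_mulV cb hH0) mulrCA ab1 mulr1.
by [].
Qed.

Variable s : seq (galg k gT).
Hypotheses (us : uniq s) (ss : size s = #|H|) (sc : forall a, a \in s -> is_char H a).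

(** First orthogonality gives the square character table a right inverse, which is also a left
    inverse. *)
Lemma char_orth2 g h : g \in H -> h \in H ->
  \sum_(a <- s) a g^-1%g * a h = (g == h)%:R * #|H|%:R.
Proof.
move=> gH hH; have nH : #|H|%:R != 0 :> k by apply: natf_neq0_char0.
pose A := \matrix_(i < #|H|, j < #|H|) (s`_i (enum_val j) : k).
pose B := \matrix_(j < #|H|, i < #|H|) (s`_i (enum_val j)^-1%g / #|H|%:R : k).
have sn (i : 'I_#|H|) : s`_i \in s by rewrite mem_nth // ss.
have AB : A *m B = 1%:M.
  apply/matrixP=> i j; rewrite !mxE.
  rewrite (eq_bigr (fun l => s`_i (enum_val l) * s`_j (enum_val l)^-1%g / #|H|%:R))
    => [|l _]; last first.
    by rewrite !mxE mulrA.
  rewrite -mulr_suml -(big_enum_val (fun h => s`_i h * s`_j h^-1%g)) /=.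
  rewrite char_orth; [|exact: sc|exact: sc].
  by rewrite mulfK // nth_uniq ?ss.
have /matrixP/(_ (enum_rank_in gH g) (enum_rank_in gH h)) := mulmx1C AB.
rewrite !mxE (can_in_eq (enum_rankK_in gH)) // => e.
apply: (mulIf (invr_neq0 nH)); rewrite mulfK // -e mulr_suml.
rewrite (big_nth 0) big_mkord ss; apply: eq_bigr => i _.
by rewrite !mxE !enum_rankK_in // mulrAC.
Qed.

(** A character missing from s is orthogonal to all of s, but second orthogonality expresses |H|
    times the indicator of 1 through s; pairing the two gives |H| = 0 in k. *)
Lemma char_complete (a : galg k gT) : is_char H a -> a \in s.
Proof.
move=> ca; apply: contraT => na.
have nH : #|H|%:R != 0 :> k by apply: natf_neq0_char0.
suff : (1 : k) * #|H|%:R = 0 by rewrite mul1r => /eqP; rewrite (negPf nH).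
transitivity (\sum_(h in H) a h * ((h == 1%g)%:R * #|H|%:R)).
  rewrite (bigD1 1%g) //= eqxx big1 ?addr0 => [|h /andP[_ /negPf->]];
    last by rewrite mul0r mulr0.
  by case: ca => -> _; rewrite !mul1r.
rewrite (eq_bigr (fun h => \sum_(b <- s) a h * b h^-1%g)) => [|h hH].
  rewrite exchange_big big_seq big1 // => b bs.
  rewrite char_orth //; last exact: sc.
  suff -> : (a == b) = false by rewrite mul0r.
  by apply: contraNF na => /eqP->.
rewrite -char_orth2 // mulr_sumr big_seq [RHS]big_seq; apply: eq_bigr => b /sc[b1 _].
by rewrite b1 mulr1.
Qed.

End Characters.

Section Idempotents.
Variables (k : closedFieldType) (gT : finGroupType) (H : {group gT}).
Hypotheses (k0 : [pchar k] =i pred0).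

Definition eid (a : galg k gT) : galg k gT := idem H a.

Lemma eidE a : eid a = \sum_(h in H) (a h^-1%g / #|H|%:R) *: gdelta k h.
Proof.
rewrite [LHS]galg_sum [RHS]big_mkcond; apply: eq_bigr => h _.
by rewrite ffunE; case: ifP; rewrite ?scale0r.
Qed.

Lemma gdelta_eid a h : is_char H a -> h \in H -> gdelta k h * eid a = a h *: eid a.
Proof.
move=> [_ [aM _]] hH; apply/galgP=> g; rewrite gdelta_mulE galg_scaleE !ffunE.
rewrite groupMl ?groupV //; case: ifP => gH; last by rewrite mulr0.
by rewrite invMg invgK [in LHS]aM ?groupV // mulrAC mulrC.
Qed.

Lemma eidM a b : is_char H a -> is_char H b -> eid b * eid a = (a == b)%:R *: eid a.
Proof.
move=> ca cb; have nH : #|H|%:R != 0 :> k by apply: natf_neq0_char0.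
rewrite {1}eidE mulr_suml.
rewrite (eq_bigr (fun h => (a h * b h^-1%g / #|H|%:R) *: eid a)) => [|h hH]; last first.
  by rewrite -scalerAl gdelta_eid // scalerA mulrAC [_ * a h]mulrC.
by rewrite -scaler_suml -mulr_suml char_orth // mulfK.
Qed.
End Idempotents.

Section Generator.
Variables (k : closedFieldType) (gT : finGroupType) (J J' : galg k (gT * gT)%type).
Variables (n : nat) (E : gT -> 'M[k]_n).
Hypotheses (k0 : [pchar k] =i pred0) (n0 : (0 < n)%N) (rE : is_rep J E).
Hypotheses (fE : limg (linfun (rho E)) = fullv) (JJ' : J * J' = 1).
Local Notation H := [group of stab E].
Local Notation D := (coefs E).
Hypothesis abH : abelian H.

(* Otherwise e_a D = 0, hence (e_a (x) 1) Delta(D) J = 0, although J is invertible. *)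
Lemma eid_neq0 a : is_char H a -> exists2 y, y \in D & eid H a * y != 0.
Proof.
move=> ca; have nH : #|H|%:R != 0 :> k by apply: natf_neq0_char0.
pose ie : 'End(galg k gT) := amull (eid H a).
suff /subvPn[y yD ny] : ~~ (D <= lker ie)%VS.
  by exists y => //; move: ny; rewrite memv_ker lfunE.
apply/negP=> /subvP e0.
have e1 u : u \in D -> eid H a * u = 0.
  by move=> /e0; rewrite memv_ker lfunE => /eqP.
have e2 t : t \in tsq E -> otimes (eid H a) 1 * t = 0.
  move=> tT; suff : t \in lker (amull (otimes (eid H a) 1)).
    by rewrite memv_ker lfunE => /eqP.
  move: t tT; apply/subvP/span_subvP=> _ /allpairsP[[u v] [/= uD _ ->]].
  rewrite memv_ker lfunE /= otimesM e1 ?vbasis_mem // otimes_push.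
  by rewrite (linear0 (push il)) mul0r.
have D0 : (0 < \dim D)%N by rewrite (dim_coefs fE) muln_gt0 n0.
have [y yD ny] : exists2 y, y \in D & y != 0.
  exists (vpick D); first exact: memv_pick.
  by rewrite vpick0 -dimv_eq0 -lt0n.
have [q nq] : exists q, y q != 0.
  apply/existsP; move: ny; apply: contraR; rewrite negb_exists => /forallP y0.
  by apply/eqP/galgP=> q; have := y0 q; rewrite negbK [RHS]ffunE => /eqP.
have := e2 _ (comul_tsq rE yD) => /(congr1 (fun t => t * J')).
rewrite mul0r -!mulrA JJ' mulr1 => /galgP/(_ (q, q)); rewrite [RHS]ffunE.
have ca1 : a 1%g = 1 by case: ca.
rewrite eidE otimes_push push1; last exact: irM.
rewrite mulr1 linear_sum mulr_suml galg_sumE (bigD1 1%g) //= [X in _ + X]big1 ?addr0.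
  rewrite linearZ /= push_gdelta -scalerAl galg_scaleE gdelta_mulE.
  have -> : ((il 1%g)^-1 * (q, q) = diag q)%g by rewrite [X in X^-1%g](_ : _ = 1%g)
    // invg1 mul1g.
  rewrite push_injE => [|? ? []//]; rewrite invg1 ca1 => /eqP.
  by rewrite !mulf_eq0 oner_eq0 invr_eq0 (negPf nH) (negPf nq).
move=> h /andP[hH nh]; rewrite linearZ /= push_gdelta -scalerAl galg_scaleE gdelta_mulE.
rewrite push_out ?mulr0 // => z; apply: contraNneq nh => -[e ez].
by apply/eqP/invg_inj/(mulIg q); rewrite -e.
Qed.

(** Choose a nonzero vector of D in each of the |H| isotypic components. They are independent, and
    |H| = dim D makes them a basis. Their sum x generates D over kH, because the idempotents of kH
    recover each vector from x. *)
Lemma exists_generator : exists x w : galg k gT,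
  [/\ x * w = 1, w * x = 1, counit x = 1, x \in D &
      forall y, y \in D -> exists2 z : galg k gT, y = z * x & forall g, g \notin H
        -> z g = 0].
Proof.
have [s [us ss sc]] := chars_exist k0 abH.
have /fin_all_exists[d dP] (i : 'I_#|H|) :
    exists y, y \in D /\ eid H s`_i * y != 0.
  have si : s`_i \in s by rewrite mem_nth ?ss.
  by have [y yD ny] := eid_neq0 (sc _ si); exists y.
have ci (i : 'I_#|H|) : is_char H s`_i by apply: sc; rewrite mem_nth ?ss.
pose v (i : 'I_#|H|) := eid H s`_i * d i.
have vD (i : 'I_#|H|) : v i \in D.
  rewrite /v eidE mulr_suml; apply: memv_suml => h hH.
  by rewrite -scalerAl memvZ // stab_mem //; case: (dP i).
have ev (i j : 'I_#|H|) : eid H s`_i * v j = (i == j)%:R *: v j.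
  rewrite /v mulrA (eidM k0) // -scalerAl nth_uniq ?ss //.
  by rewrite eq_sym.
have fv : free [tuple v i | i < #|H|].
  apply/freeP=> c c0 i; have := congr1 (fun y => eid H s`_i * y) c0.
  rewrite mulr0 mulr_sumr (bigD1 i) //= [X in _ + X]big1 ?addr0 => [|j nj].
    rewrite (nth_mktuple _ _ i) -scalerAr ev eqxx scale1r => /eqP.
    by rewrite scaler_eq0 => /orP[/eqP//|]; case: (dP i) => _ /negPf->.
  by rewrite (nth_mktuple _ _ j) -scalerAr ev eq_sym (negPf nj) scale0r scaler0.
have bv : basis_of D [tuple v i | i < #|H|].
  rewrite basisEfree fv size_tuple (dim_coefs fE) -(card_stab n0 rE fE JJ') leqnn andbT.
  by apply/span_subvP=> _ /mapP[i _ ->].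
pose x := \sum_i v i.
have gen y : y \in D -> exists2 z : galg k gT, y = z * x & forall g, g \notin H ->
  z g = 0.
  move=> yD; exists (\sum_i coord [tuple v i | i < #|H|] i y *: eid H s`_i).
    rewrite {1}(coord_basis bv yD) mulr_suml; apply: eq_bigr => i _.
    rewrite (nth_mktuple _ _ i) -scalerAl; congr (_ *: _).
    rewrite /x mulr_sumr (bigD1 i) //= ev eqxx scale1r big1 ?addr0 // => j nj.
    by rewrite ev eq_sym (negPf nj) scale0r.
  move=> g ng; rewrite galg_sumE big1 // => i _; rewrite galg_scaleE [eid _ _ _]ffunE.
  by rewrite (negPf ng) mulr0.
have gen' (y : galg k gT) : y \in D -> exists z : galg k gT, y = z * x.
  by move=> /gen[z -> _]; exists z.
have [w wx] := cyclic_left_inv n0 rE fE JJ' gen'.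
have ewx : counit w * counit x = 1 by rewrite -counitM wx counit1.
have nex : counit x != 0.
  by apply: contra_eq_neq ewx => ->; rewrite mulr0 eq_sym oner_neq0.
have counitZ (c : k) (y : galg k gT) : counit (c *: y) = c * counit y.
  by rewrite /counit mulr_sumr; apply: eq_bigr => g _; rewrite galg_scaleE.
(* Rescaling secures the counit normalization; [counit x] is nonzero because x is invertible. *)
exists ((counit x)^-1 *: x), (counit x *: w); split.
- by rewrite -scalerAl -scalerAr scalerA mulVf // scale1r (galg_mulV wx).
- by rewrite -scalerAl -scalerAr scalerA divff // scale1r.
- by rewrite counitZ mulVf.
- by rewrite memvZ // memv_suml.
move=> y /gen[z -> nz]; exists (counit x *: z).
  by rewrite -scalerAl -scalerAr scalerA divff // scale1r.
by move=> g /nz zg; rewrite galg_scaleE zg mulr0.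
Qed.

(** Delta(x) J lies in D (x) D, and D w is contained in kH x w = kH. *)
Lemma gauge_support (x w : galg k gT) : x * w = 1 -> x \in D ->
  (forall y, y \in D -> exists2 z : galg k gT, y = z * x & forall g, g \notin H ->
    z g = 0) ->
  forall p, gauge J x w p != 0 -> (p.1 \in H) && (p.2 \in H).
Proof.
move=> xw xD gen p; apply: contraR => np.
have zw u : u \in D -> forall g, g \notin H -> (u * w) g = 0.
  by move=> /gen[z -> nz]; rewrite -mulrA xw mulr1.
suff H0 t : t \in tsq E -> (t * otimes w w) p = 0 by rewrite /gauge H0 ?comul_tsq.
pose S := [seq otimes u v | u <- vbasis D, v <- vbasis D].
rewrite -[tsq E]/(<<in_tuple S>>%VS) => /coord_span->.
rewrite mulr_suml galg_sumE big1 // => i _; rewrite -scalerAl galg_scaleE.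
have /allpairsP[[u v] [/= /vbasis_mem uD /vbasis_mem vD ->]] : (in_tuple S)`_i \in S.
  exact: (mem_nth 0 (ltn_ord i)).
rewrite otimesM otimesE; move: np; rewrite negb_and => /orP[/(zw _ uD)->|/(zw _ vD)->].
  by rewrite mul0r mulr0.
by rewrite !mulr0.
Qed.
End Generator.

(** H is only produced inside the proof, so commutativity is assumed for every subgroup of square
    order. *)
Lemma minimal_support (k : closedFieldType) (gT : finGroupType) (J : galg k (gT *
  gT)%type) :
  [pchar k] =i pred0 -> is_twist J ->
  (forall (H : {group gT}) n, #|H| = (n * n)%N -> abelian H) ->
  exists (H : {group gT}) (x w : galg k gT),
   [/\ exists n, #|H| = (n * n)%N, x * w = 1, w * x = 1, counit x = 1 &
    forall p, gauge J x w p != 0 -> (p.1 \in H) && (p.2 \in H)].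
Proof.
move=> k0 tJ ab; have [n [E [n0 rE fE]]] := irr_rep tJ.
have [J' [JJ' _]] : exists J', J * J' = 1 /\ J' * J = 1 by case/is_twistP: tJ.
have cH := card_stab n0 rE fE JJ'.
have abH : abelian [group of stab E] by apply: (ab _ n).
have [x [w [xw wx ex xD gen]]] := exists_generator k0 n0 rE fE JJ' abH.
exists [group of stab E], x, w; split=> //; first by exists n.
move=> p; apply: (gauge_support rE xw xD _) => y yD.
by case: (gen y yD) => z; exists z.
Qed.

(** * Twists supported on an abelian subgroup and their cocycles *)

Section CharMul.
Variables (k : fieldType) (gT : finGroupType) (H : {group gT}).
Implicit Types a b : galg k gT.

(** For x outside H both sides are 0, so only z has to lie in H. *)
Lemma charM_left a z x : is_char H a -> z \in H -> a (z * x)%g = a z * a x.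
Proof.
move=> [_ [aM a0]] zH; have [xH|nx] := boolP (x \in H); first exact: aM.
by rewrite (a0 x) // a0 ?mulr0 // groupMl.
Qed.

Lemma chmul_char a b : is_char H a -> is_char H b -> is_char H (chmul a b).
Proof.
move=> [a1 [aM a0]] [b1 [bM b0]]; split; first by rewrite ffunE a1 b1 mulr1.
split=> [x y xH yH|x nx]; last by rewrite ffunE a0 // mul0r.
by rewrite !ffunE aM // bM // mulrACA.
Qed.

Lemma chtriv_char : is_char H (chtriv k H).
Proof.
split; first by rewrite ffunE group1.
by split=> [x y xH yH|x nx]; rewrite !ffunE ?(negPf nx) // groupM // xH yH mulr1.
Qed.
End CharMul.

Lemma chmulC (k : fieldType) (gT : finGroupType) (a b : {ffun gT -> k}) : chmul a b
  = chmul b a.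
Proof. by apply/ffunP=> g; rewrite !ffunE mulrC. Qed.

Section Supported.
Variables (k : closedFieldType) (gT : finGroupType) (H : {group gT}).
Variables (J : galg k (gT * gT)%type).
Hypotheses (k0 : [pchar k] =i pred0) (abH : abelian H) (tJ : is_twist J).
Hypothesis (sJ : forall p, J p != 0 -> (p.1 \in H) && (p.2 \in H)).
Implicit Types a b c : {ffun gT -> k}.

(** The value at K of a (x) b extended linearly; for characters of H and K in kH (x) kH it is the
    coefficient of e_a (x) e_b in K. *)
Definition omega (K : galg k (gT * gT)%type) a b := \sum_p K p * (a p.1 * b p.2).

Lemma omegaE K a b : omega K a b = \sum_x \sum_y K (x, y) * (a x * b y).
Proof. by rewrite /omega [RHS]pair_big; apply: eq_bigr => -[]. Qed.

Lemma supp0 x y : ~~ ((x \in H) && (y \in H)) -> J (x, y) = 0.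
Proof. by move=> n; apply: contraNeq n => /sJ. Qed.

(** Support is required of the left factor only, so K may be the inverse of J, whose support is not
    known. *)
Lemma omegaM K a b : is_char H a -> is_char H b -> omega (J * K) a b = omega J a b
  * omega K a b.
Proof.
move=> ca cb; rewrite {2}/omega mulr_suml {1}/omega.
transitivity (\sum_q \sum_p J q * K (q^-1 * p)%g * (a p.1 * b p.2)).
  rewrite exchange_big; apply: eq_bigr => p _; rewrite galg_mulE mulr_suml.
  by [].
apply: eq_bigr => -[x y] _;
  have [/andP[xH yH]|n] := boolP ((x \in H) && (y \in H)); last first.
  by rewrite supp0 // !mul0r big1 // => p _; rewrite !mul0r.
rewrite (reindex_inj (mulgI (x, y))) /omega mulr_sumr; apply: eq_bigr => -[x' y'] _.
rewrite mulKg /= (charM_left _ ca xH) (charM_left _ cb yH).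
by rewrite (mulrACA (a x)) (mulrACA (J _)).
Qed.

Lemma omega_neq0 a b : is_char H a -> is_char H b -> omega J a b != 0.
Proof.
move=> ca cb; have [J' [JJ' _]] : exists J', J * J' = 1 /\ J' * J = 1 by
  case/is_twistP: tJ.
have : omega (J * J') a b = 1.
  rewrite JJ' /omega (bigD1 (1%g, 1%g)) //= big1 ?addr0 => [|p np]; last first.
    by rewrite galg_oneE (negPf np) mul0r.
  by rewrite galg_oneE eqxx mul1r; case: ca cb => -> _ [-> _]; rewrite mulr1.
by rewrite omegaM //; apply: contra_eq_neq => ->; rewrite mul0r eq_sym oner_neq0.
Qed.

(** The twist equation evaluated at a (x) b (x) c: Delta on a leg multiplies two characters, and
    shifting the summation variables by an element of H separates the two copies of J. *)
Lemma omega_cocycle a b c : is_char H a -> is_char H b -> is_char H c ->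
  omega J a b * omega J (chmul a b) c = omega J b c * omega J a (chmul b c).
Proof.
move=> ca cb cc.
transitivity (\sum_x \sum_y \sum_z (\sum_u J (u, z) * J (u^-1 * x, u^-1 * y)%g) *
  (a x * b y * c z)).
  rewrite mulrC [omega J (chmul a b) c]omegaE mulr_suml.
  transitivity (\sum_u \sum_z \sum_x \sum_y J (u, z) * J (u^-1 * x, u^-1 * y)%g *
    (a x * b y * c z)).
    apply: eq_bigr => u _; rewrite mulr_suml; apply: eq_bigr => z _.
    have [/andP[uH zH]|n] := boolP ((u \in H) && (z \in H)); last first.
      by rewrite supp0 // !mul0r big1 // => x _; rewrite big1 // => y _; rewrite !mul0r.
    rewrite omegaE mulr_sumr [RHS](reindex_inj (mulgI u)); apply: eq_bigr => x _.
    rewrite mulr_sumr [RHS](reindex_inj (mulgI u)); apply: eq_bigr => y _.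
    rewrite !mulKg (charM_left _ ca uH) (charM_left _ cb uH) ffunE.
    rewrite mulrACA; congr (_ * _); rewrite mulrAC; congr (_ * _).
    by rewrite mulrACA.
  rewrite [LHS](eq_bigr (fun u => \sum_x \sum_y \sum_z J (u, z) * J (u^-1 * x, u^-1
    * y)%g * (a x * b y * c z))).
    rewrite exchange_big; apply: eq_bigr => x _; rewrite exchange_big;
      apply: eq_bigr => y _.
    rewrite exchange_big; apply: eq_bigr => z _.
    by rewrite mulr_suml.
  move=> u _; rewrite exchange_big; apply: eq_bigr => x _; rewrite exchange_big.
  by [].
rewrite mulrC [omega J a (chmul b c)]omegaE mulr_suml; apply/esym.
apply: eq_bigr => x _.
transitivity (\sum_u \sum_y \sum_z J (x, u) * J (u^-1 * y, u^-1 * z)%g * (a x * b y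
  * c z)).
  rewrite mulr_suml; apply: eq_bigr => u _.
  have [/andP[xH uH]|n] := boolP ((x \in H) && (u \in H)); last first.
    by rewrite supp0 // !mul0r big1 // => y _; rewrite big1 // => z _; rewrite !mul0r.
  rewrite omegaE mulr_sumr [RHS](reindex_inj (mulgI u)); apply: eq_bigr => y _.
  rewrite mulr_sumr [RHS](reindex_inj (mulgI u)); apply: eq_bigr => z _.
  rewrite !mulKg (charM_left _ cb uH) (charM_left _ cc uH) ffunE.
  rewrite mulrACA; congr (_ * _); rewrite -!mulrA; congr (_ * _).
  by rewrite (mulrCA (c u)).
rewrite exchange_big; apply: eq_bigr => y _; rewrite exchange_big;
  apply: eq_bigr => z _.
by rewrite twist_eq_at // mulr_suml.
Qed.

Lemma omega_triv a : is_char H a -> omega J (chtriv k H) a = 1 /\ omega J a (chtriv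
  k H) = 1.
Proof.
have /is_twistP[_ _ c1 c2] := tJ; move=> [a1 _]; split.
  rewrite omegaE exchange_big (bigD1 1%g) //= [X in _ + X]big1 ?addr0 => [|y ny].
    transitivity (push snd J 1%g); last by rewrite c1 galg_oneE eqxx.
    rewrite push_sndE; apply: eq_bigr => x _; rewrite a1 ffunE mulr1.
    by have [_|nx] := boolP (x \in H); rewrite ?mulr1 // supp0 ?mul0r // negb_and nx.
  transitivity (push snd J y * a y); last by rewrite c1 galg_oneE (negPf ny) mul0r.
  rewrite push_sndE mulr_suml; apply: eq_bigr => x _; rewrite ffunE.
  by have [_|nx] := boolP (x \in H); rewrite ?mul1r // supp0 ?mul0r // negb_and nx.
rewrite omegaE (bigD1 1%g) //= [X in _ + X]big1 ?addr0 => [|x nx].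
  transitivity (push fst J 1%g); last by rewrite c2 galg_oneE eqxx.
  rewrite push_fstE; apply: eq_bigr => y _; rewrite a1 ffunE mul1r.
  by have [_|ny] := boolP (y \in H); rewrite ?mulr1 // supp0 ?mul0r // negb_and ny orbT.
transitivity (push fst J x * a x); last by rewrite c2 galg_oneE (negPf nx) mul0r.
rewrite push_fstE mulr_suml; apply: eq_bigr => y _; rewrite ffunE.
by have [_|ny] := boolP (y \in H); rewrite ?mulr1 // supp0 ?mul0r // negb_and ny orbT.
Qed.

Variable s : seq (galg k gT).
Hypotheses (us : uniq s) (ss : size s = #|H|) (sc : forall a, a \in s -> is_char H a).

(** Fourier inversion in both legs: second orthogonality isolates the coefficient of J at p. *)
Lemma fourier p : J p = \sum_(a <- s) \sum_(b <- s) omega J a b * (idem H a p.1 *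
  idem H b p.2).
Proof.
have nH : #|H|%:R != 0 :> k by apply: natf_neq0_char0.
have o2 := char_orth2 k0 us ss sc.
case: p => x y /=; have [/andP[xH yH]|n] := boolP ((x \in H) && (y \in H)); last first.
  rewrite supp0 // big1 // => a _; rewrite big1 // => b _; rewrite !ffunE.
  by move: n; rewrite negb_and => /orP[/negPf->|/negPf->]; rewrite ?mul0r ?mulr0.
transitivity (\sum_u \sum_v J (u, v) * ((\sum_(a <- s) a x^-1%g * a u) / #|H|%:R) *
     ((\sum_(b <- s) b y^-1%g * b v) / #|H|%:R)).
  rewrite (bigD1 x) //= (bigD1 y) //= !o2 // !eqxx !mul1r divff // !mulr1.
  rewrite [X in _ + X + _]big1 ?addr0 => [|v nv].
    rewrite [X in _ + X]big1 ?addr0 // => u nu; rewrite big1 // => v _.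
    have [/andP[uH vH]|n] := boolP ((u \in H) && (v \in H));
      last by rewrite supp0 ?mul0r.
    by rewrite o2 // eq_sym (negPf nu) !mul0r mulr0 mul0r.
  have [vH|n] := boolP (v \in H); last by rewrite supp0 ?mul0r // negb_and n orbT.
  by rewrite [X in _ * (X / _)]o2 // eq_sym (negPf nv) !mul0r mulr0.
transitivity (\sum_u \sum_v \sum_(a <- s) \sum_(b <- s)
    J (u, v) * (a u * b v) * (idem H a x * idem H b y)).
  apply: eq_bigr => u _; apply: eq_bigr => v _.
  rewrite [X in _ * X * _]mulr_suml [X in X * _]mulr_sumr mulr_suml;
    apply: eq_bigr => a _.
  rewrite [X in _ * X]mulr_suml mulr_sumr; apply: eq_bigr => b _; rewrite !ffunE xH yH.
  by ring.
rewrite exchange_big [RHS](eq_bigr (fun a => \sum_v \sum_u \sum_(b <- s) J (u, v) *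
  (a u * b v) * (idem H a x * idem H b y))) /=.
  rewrite [RHS]exchange_big; apply: eq_bigr => v _; rewrite [RHS]exchange_big;
    apply: eq_bigr => u _.
  by [].
move=> a _; rewrite [RHS](eq_bigr (fun v => \sum_(b <- s) \sum_u J (u, v) * (a u *
  b v) * (idem H a x * idem H b y))).
  rewrite [RHS]exchange_big; apply: eq_bigr => b _;
    rewrite omegaE exchange_big mulr_suml.
  by apply: eq_bigr => v _; rewrite mulr_suml.
by move=> v _; rewrite exchange_big.
Qed.

Lemma omega_sym_swap : (forall a b, a \in s -> b \in s -> omega J a b = omega J b a) ->
  push swap J = J.
Proof.
move=> sym; rewrite -flipE; apply/ffunP=> -[x y];
  rewrite ffunE /= [LHS]fourier [RHS]fourier.
rewrite exchange_big big_seq [RHS]big_seq; apply: eq_bigr => a as_.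
rewrite big_seq [RHS]big_seq; apply: eq_bigr => b bs.
by rewrite sym //= mulrC [X in X * _]mulrC [RHS]mulrC.
Qed.

Lemma supported_lifted : push swap J <> J -> lifted_twist_nontriv H J.
Proof.
move=> nsw; exists s, (omega J); split.
  split=> [|a].
    elim: (s) us => [|a t IH]; first by constructor.
    by case/andP=> na ut; constructor; [rewrite In_mem; exact/negP|exact: IH].
  rewrite In_mem; split; first exact: sc.
  by move=> ca; apply: (char_complete k0 us ss sc).
split.
  split=> [a b /In_mem as_ /In_mem bs|]; first by apply: omega_neq0; exact: sc.
  split=> [a b c /In_mem as_ /In_mem bs /In_mem cs|a /In_mem as_].
    by apply: omega_cocycle; exact: sc.
  by apply: omega_triv; exact: sc.
split; last by apply/ffunP=> p; rewrite ffunE; exact: fourier.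
case=> f [nf cf]; apply: nsw; apply: omega_sym_swap => a b as_ bs.
rewrite !cf ?In_mem //; try exact/In_mem.
by rewrite chmulC [f a * _]mulrC.
Qed.

End Supported.

(** No coboundary is exhibited: symmetry follows from the cocycle identity alone, by induction along
    the powers [w i] of a generator of the dual group. *)
Lemma supported_cyclic (k : closedFieldType) (gT : finGroupType) (H : {group gT})
   (J : galg k (gT * gT)%type) : [pchar k] =i pred0 -> cyclic H -> is_twist J ->
  (forall p, J p != 0 -> (p.1 \in H) && (p.2 \in H)) -> push swap J = J.
Proof.
move=> k0 cH tJ sJ; have abH := cyclic_abelian cH.
have [s [us ss sc]] := chars_exist k0 abH.
have [h defH] := cyclicP cH.
have hH : h \in H by rewrite defH cycle_id.
have aX a m : is_char H a -> a (h ^+ m)%g = a h ^+ m.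
  case=> a1 [aM _]; elim: m => [|m IH]; first by rewrite a1.
  by rewrite expgS aM ?groupX // IH exprS.
have char_eq a b : is_char H a -> is_char H b -> a h = b h -> a = b.
  move=> ca cb eab; apply/ffunP=> g; have [gH|ng] := boolP (g \in H).
    by move: gH; rewrite defH => /cycleP[m ->]; rewrite !aX // eab.
  by case: ca cb => [_ [_ ->]] // [_ [_ ->]].
(* The |H| characters take distinct values at h, all of them |H|-th roots of unity, so one of the
   values is primitive and its character generates the dual group. *)
have : has #|H|.-primitive_root [seq (a : {ffun gT -> k}) h | a <- s].
  apply: has_prim_root => //.
  - apply/allP=> _ /mapP[a as_ ->]; rewrite unity_rootE -aX; last exact: sc.
    by rewrite expg_cardG //; case: (sc a as_) => ->.
  - rewrite map_inj_in_uniq // => a b as_ bs; apply: char_eq; exact: sc.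
  by rewrite size_map ss.
case/hasP=> _ /mapP[c cs ->] prim.
pose w i := iter i (chmul c) (chtriv k H).
have cw i : is_char H (w i).
  by elim: i => [|i IH]; [exact: chtriv_char|apply: chmul_char IH; exact: sc].
have wh i : w i h = c h ^+ i.
  by elim: i => [|i IH]; rewrite /= ffunE ?hH // IH exprS.
have wD i j : chmul (w i) (w j) = w (i + j)%N.
  apply: char_eq; [exact: chmul_char|exact: cw|].
  by rewrite ffunE !wh exprD.
have swap a : a \in s -> exists i, a = w i.
  move=> as_; have /(prim_rootP prim)[i ei] : a h ^+ #|H| = 1.
    by rewrite -aX ?expg_cardG //; [case: (sc a as_)|exact: sc].
  by exists i; apply: char_eq; [exact: sc|exact: cw|rewrite wh].
have nz i j : omega J (w i) (w j) != 0 := omega_neq0 tJ sJ (cw i) (cw j).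
have coc i j l : omega J (w i) (w j) * omega J (w (i + j)%N) (w l) =
                 omega J (w j) (w l) * omega J (w i) (w (j + l)%N).
  by rewrite -!wD; exact: (omega_cocycle tJ sJ (cw i) (cw j) (cw l)).
(* In the identity for (1, j, 1) the outer factors agree by induction and cancel. *)
have s1 j : omega J (w 1%N) (w j) = omega J (w j) (w 1%N).
  elim: j => [|j IH].
    by have [e1 e2] := omega_triv tJ sJ (cw 1%N); rewrite [LHS]e2 [RHS]e1.
  have := coc 1%N j 1%N; rewrite IH addnC !addn1 => /(mulfI (nz _ _)) ->.
  by [].
apply: (omega_sym_swap k0 sJ us ss sc) => a b /swap[i ->] /swap[j ->] {a b}.
elim: i j => [|i IH] j.
  by have [e1 e2] := omega_triv tJ sJ (cw j); rewrite [LHS]e1 [RHS]e2.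
(* The identities for (i, 1, j) and (j, 1, i) are matched through the induction hypothesis at j +
   1. *)
have := coc i 1%N j; have := coc j 1%N i; rewrite !addn1 !add1n => e1 e2.
apply: (mulfI (nz i 1%N)); rewrite e2.
by rewrite IH s1 e1 s1.
Qed.

(** * Transport along group isomorphisms *)

Section Transport.
Variables (k : fieldType) (gT hT : finGroupType) (f : gT -> hT) (f' : hT -> gT).
Hypotheses (fM : {morph f : x y / (x * y)%g}) (fK : cancel f f') (f'K : cancel f' f).

Definition map_pair (p : gT * gT) := (f p.1, f p.2).

Lemma map_pairM : {morph map_pair : x y / (x * y)%g}.
Proof. by move=> x y; congr (_, _); apply: fM. Qed.

Lemma map_pair_inj : injective map_pair.
Proof. by move=> [a b] [c d] [/(can_inj fK)-> /(can_inj fK)->]. Qed.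

Lemma transport1 : f 1%g = 1%g.
Proof. by apply: (mulgI (f 1%g)); rewrite -fM !mulg1. Qed.

Lemma push_map_pair_swap (J : galg k (gT * gT)%type) : push swap (push map_pair J)
  = push map_pair (push swap J).
Proof. by rewrite !push_comp. Qed.

Lemma push_map_pair_inj : injective (push map_pair : galg k (gT * gT)%type -> galg
  k (hT * hT)%type).
Proof. by move=> s t e; apply/galgP=> p; rewrite -!(push_injE _ _ map_pair_inj) e. Qed.

Lemma transport_twist (J : galg k (gT * gT)%type) : is_twist J -> is_twist (push
  map_pair J : galg k (hT * hT)%type).
Proof.
move=> /is_twistP[[J' [JJ' J'J]] tJ c1 c2]; apply/is_twistP; split.
- by exists (push map_pair J'); split;
  rewrite -(pushM map_pairM) ?JJ' ?J'J push1 //; exact: map_pairM.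
- pose f3 (q : (gT * gT) * gT) := (map_pair q.1, f q.2).
  have f3M : {morph f3 : x y / (x * y)%g}.
    by move=> x y; congr (_, _); [apply: map_pairM|apply: fM].
  have := congr1 (push f3) tJ; rewrite !(pushM f3M) !push_comp.
  rewrite (push_ext (f' := f3 \o m12) (f := m12 \o map_pair)); last by move=> p;
    congr (_, _); rewrite /= transport1.
  rewrite (push_ext (f' := f3 \o m23) (f := m23 \o map_pair)); last by move=> p;
    congr ((_, _), _); rewrite /= transport1.
  by move=> <-.
- by rewrite push_comp -[RHS](push1 k fM) -c1 push_comp.
- by rewrite push_comp -[RHS](push1 k fM) -c2 push_comp.
Qed.

Lemma push_map_pair_otimes (u v : galg k gT) : push map_pair (otimes u v) = otimes
  (push f u) (push f v).
Proof.
rewrite !otimes_push (pushM map_pairM) !push_comp; congr (_ * _); apply: push_ext => g;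
  by congr (_, _); rewrite /= transport1.
Qed.

Lemma push_map_pair_support (H : {set gT}) (J : galg k (gT * gT)%type) :
  (forall p, J p != 0 -> (p.1 \in H) && (p.2 \in H)) ->
  forall q, push map_pair J q != 0 -> (q.1 \in f @: H) && (q.2 \in f @: H).
Proof.
move=> sJ [a b]; rewrite -[a]f'K -[b]f'K -[(_, _)]/(map_pair (f' a, f' b))
  push_injE; last exact: map_pair_inj.
by move/sJ=> /= /andP[aH bH]; rewrite !imset_f.
Qed.

(** The map is z |-> f(x z x^-1). Conjugating J^-1 Delta(z) J by x (x) x gives the coproduct of x z
    x^-1 twisted by Delta(x) J (x^-1 (x) x^-1). *)
Lemma gauge_hopf_iso (J : galg k (gT * gT)%type) (x w : galg k gT) :
  x * w = 1 -> w * x = 1 ->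
  hopf_isomorphic J (push map_pair (gauge J x w)).
Proof.
move=> xw wx; pose F (z : galg k gT) : galg k hT := push f (x * z * w).
have FM (y z : galg k gT) : F (y * z) = F y * F z.
  by rewrite /F -pushM // !mulrA -(mulrA (x * y) w) wx mulr1.
have F1 : F 1 = 1 by rewrite /F mulr1 xw push1.
have counit_push (z : galg k gT) : counit (push f z) = counit z.
  have /galgP/(_ 1%g) : counit (push f z) *: gdelta k (1%g : hT) = counit z *:
    gdelta k (1%g : hT).
    by rewrite -!push_cst push_comp.
  by rewrite !galg_scaleE !gdeltaE eqxx !mulr1.
have ewx : counit x * counit w = 1 by rewrite -counitM xw counit1.
exists F; split.
  have linE (lT : finGroupType) c (u v : galg k lT) : [ffun g => c * u g + v g] = c
    *: u + v.
    by apply/galgP=> g; rewrite [LHS]ffunE galg_addE galg_scaleE.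
  move=> c y z; rewrite [RHS](linE hT c (F y) (F z)) (linE gT c y z).
  by rewrite /F mulrDr mulrDl -scalerAr -scalerAl linearP.
split.
  exists (fun z : galg k hT => w * push f' z * x) => z.
    rewrite /F push_comp (push_ext (f' := id)) ?push_id //.
    by rewrite !mulrA wx mul1r -mulrA wx mulr1.
  rewrite /F !mulrA xw mul1r -mulrA xw mulr1 push_comp (push_ext (f' := id))
    ?push_id //.
split; first exact: F1.
split; first exact: FM.
split.
  move=> z; change (counit (F z) = counit z).
  by rewrite /F counit_push !counitM mulrC mulrA [counit w * _]mulrC ewx mul1r.
move=> Ji J0i; change (inv_of J Ji -> inv_of (push map_pair (gauge J x w)) J0i ->
  forall z : galg k gT,
   tmap F (comulJ J Ji z) = comulJ (push map_pair (gauge J x w)) J0i (F z)) =>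
     [[JJi JiJ] [J0J0i J0iJ0] z].
have tE (t : galg k (gT * gT)%type) : tmap F t = push map_pair (otimes x x * t *
  otimes w w).
  rewrite [in RHS](galg_sum t) mulr_sumr mulr_suml linear_sum.
  apply/ffunP=> q; rewrite ffunE galg_sumE; apply: eq_bigr => -[a b] _ /=.
  rewrite -scalerAr -scalerAl linearZ galg_scaleE /=; congr (_ * _).
  by rewrite -otimes_gdelta !otimesM push_map_pair_otimes otimesE.
(* The inverse of the gauge transform, (x (x) x) J^-1 Delta(x^-1). *)
pose K : galg k (gT * gT)%type := otimes x x * Ji * push diag w.
have KE : push map_pair K = J0i.
  have e : push map_pair K * push map_pair (gauge J x w) = 1.
    rewrite -(pushM map_pairM) /K /gauge !mulrA -(mulrA _ (push diag w)) -(pushM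
      (@diagM gT)) wx.
    rewrite (push1 _ (@diagM gT)) mulr1 -(mulrA _ _ J).
    by rewrite [_ * J]JiJ mulr1 otimesM xw otimes1 (push1 _ map_pairM).
  exact: left_right_inv_eq e J0J0i.
have dgF : push diag (F z) = push map_pair (push diag (x * z * w)) by rewrite
  !push_comp.
rewrite tE /comulJ !comulE dgF.
change (push map_pair (otimes x x * ((Ji : galg k (gT * gT)%type) * (push diag z *
  J)) * otimes w w) =
  (J0i : galg k (hT * hT)%type) * (push map_pair (push diag (x * z * w)) * push
    map_pair (gauge J x w))).
rewrite -KE -!(pushM map_pairM) /K /gauge; congr (push map_pair _).
rewrite !(pushM (@diagM gT)) !mulrA.
have dwx : push diag w * push diag x = 1 by rewrite -(pushM (@diagM gT)) wx (push1
  _ (@diagM gT)).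
by rewrite -(mulrA _ (push diag w) (push diag x)) dwx mulr1 -(mulrA _ (push diag w)
  (push diag x)) dwx mulr1.
Qed.
End Transport.

(** * The case of order 60 *)

Lemma elementary_order4 (gT : finGroupType) (V : {group gT}) : #|V| = 4%N -> ~~
  cyclic V ->
  forall u, u \in V -> (u ^+ 2 = 1)%g.
Proof.
move=> oV ncV u Vu; apply/eqP; rewrite -order_dvdn; apply: contraR ncV => n2.
have o4 : #[u]%g = 4%N.
  have d4 : (#[u]%g %| 4)%N by rewrite -oV order_dvdG.
  have := dvdn_leq (isT : 0 < 4)%N d4; move: d4 n2.
  by case: #[u]%g => [|[|[|[|[|m]]]]].
apply/cyclicP; exists u; apply/eqP; rewrite eq_sym eqEcard cycle_subG Vu oV.
by rewrite -/#[u]%g o4.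
Qed.

Lemma group60_klein (gT : finGroupType) (V : {group gT}) : #|gT| = 60%N ->
  'Z([set: gT])%g = 1%g -> #|V| = 4%N -> ~~ cyclic V ->
  (exists f : gT -> A5T, [/\ {morph f : x y / (x * y)%g}, injective f & f @: V = H0]) \/
  ([set: gT] \isog [set: D3xD5])%g.
Proof.
move=> oG Z1 oV ncV; have V2 := elementary_order4 oV ncV.
have [sNC|nNC] := boolP ('N(V) \subset 'C(V))%g; last by left; apply: klein_A5.
right; have sylV : (2.-Sylow([set: gT]) V)%g by rewrite pHallE subsetT oV cardsT oG
  p_part.
have [K defG] := Burnside_complement sylV (subset_trans (subsetIr _ _) sNC).
by apply: klein_complement defG oV V2; rewrite ?cardsT.
Qed.

Lemma klein_isog (gT : finGroupType) (V : {group gT}) : #|V| = 4%N ->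
  (forall u, u \in V -> u ^+ 2 = 1)%g -> (V \isog [set: ('Z_2 * 'Z_2)%type])%g.
Proof.
move=> oV V2.
have abV : (2.-abelem V)%g.
  by rewrite abelemE // (klein_abelian V2); apply/exponentP.
rewrite (isog_abelem_card _ abV) oV cardsT card_prod !card_ord andbT abelemE //.
apply/andP; split.
  (* The group law of ['Z_2] is the addition of the ring. *)
  by apply/centsP=> -[a b] _ [c d] _; congr (_, _); exact: (addrC (_ : 'Z_2)).
by apply/exponentP=> -[[[|[|a]] Ha] [[|[|b]] Hb]] _ //; apply/eqP.
Qed.

Lemma order_square60 (gT : finGroupType) (H : {group gT}) n : #|gT| = 60%N ->
  #|H| = (n * n)%N -> #|H| = 1%N \/ #|H| = 4%N.
Proof.
move=> oG oH; have d60 : (n * n %| 60)%N by rewrite -oH -oG -cardsT cardSg ?subsetT.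
(* Since 8^2 > 60, only finitely many n remain to be tested. *)
have n8 : (n < 8)%N.
  rewrite ltnNge; apply/negP=> n8.
  by have := leq_trans (leq_mul n8 n8) (dvdn_leq (isT : 0 < 60)%N d60).
rewrite oH; move: d60 n8 {oH}; case: n => [|[|[|[|[|[|[|[|n]]]]]]]] //.
  by left.
by right.
Qed.

(** To be used with f onto A_5 or D_3 x D_5. The class stays nontrivial because flip-symmetry of the
    transported twist would travel back through f and the gauge transform to J. *)
Lemma supported_transport (k : closedFieldType) (gT hT : finGroupType) (f : gT -> hT)
  (J : galg k (gT * gT)%type) (H : {group gT}) (H' : {group hT}) (x w : galg k gT) :
  [pchar k] =i pred0 -> is_twist J -> push swap J <> J -> abelian H ->
  x * w = 1 -> w * x = 1 -> counit x = 1 ->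
  (forall p, gauge J x w p != 0 -> (p.1 \in H) && (p.2 \in H)) ->
  {morph f : a b / (a * b)%g} -> bijective f -> f @: H = H' ->
  exists J0 : {ffun (hT * hT)%type -> k},
      lifted_twist_nontriv H' J0 /\ hopf_isomorphic J J0.
Proof.
move=> k0 tJ nsJ abH xw wx ex sJ fM [f' fK f'K] fH.
exists (push (map_pair f) (gauge J x w)); split;
  last exact: (gauge_hopf_iso fM fK f'K J xw wx).
have tg := gauge_twist xw wx ex tJ.
have abH' : abelian H'.
  apply/centsP=> a + b; rewrite -fH => /imsetP[c Hc ->] /imsetP[d Hd ->].
  by rewrite /commute -!fM (centsP abH).
have [s [us ss sc]] := chars_exist k0 abH'.
apply: (supported_lifted k0 _ _ us ss sc).
- refine (transport_twist fM tg).
- by have := push_map_pair_support fK f'K sJ; rewrite fH.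
rewrite push_map_pair_swap => /(push_map_pair_inj fK) sg; apply: nsJ.
exact: gauge_sym wx sg.
Qed.

Unset Implicit Arguments.

Theorem theorem4p8 (k : closedFieldType) (gT : finGroupType)
  (J : {ffun (gT * gT)%type -> k}) :
  [pchar k] =i pred0 ->
  #|gT| = 60%N ->
  is_twist J ->
  ~ cocomm J ->
  hopf_simple J ->
  ( ([set: gT] \isog [set: A5T])%g /\
    exists J0 : {ffun (A5T * A5T)%type -> k},
      lifted_twist_nontriv H0 J0 /\ hopf_isomorphic J J0 )
  \/
  ( ([set: gT] \isog [set: D3xD5])%g /\
    exists (H1 : {group D3xD5}) (J1 : {ffun (D3xD5 * D3xD5)%type -> k}),
      (H1 \isog [set: ('Z_2 * 'Z_2)%type])%g /\
      lifted_twist_nontriv H1 J1 /\ hopf_isomorphic J J1 ).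
Proof.
move=> k0 oG tJ ncJ sJ.
(* Noncocommutativity is used only through this asymmetry of J. *)
have nsJ : push swap (J : galg k (gT * gT)%type) <> J by move=> /sym_cocomm.
have Z1 : 'Z([set: gT])%g = 1%g by apply: (simple_center tJ sJ); rewrite oG.
have ab (H : {group gT}) n : #|H| = (n * n)%N -> abelian H.
  move=> /(order_square60 oG)[/eqP|o4]; first by rewrite -trivg_card1 => /eqP->; exact: abelian1.
  by apply: (p2group_abelian (p := 2)); rewrite ?/pgroup o4.
have [H [x [w [[n oH] xw wx ex supp]]]] := minimal_support k0 tJ ab.
(* A cyclic H, the trivial one included, would make the gauge transform symmetric and then J
   itself. *)
have ncH : ~~ cyclic H.
  apply/negP=> cH; apply: nsJ; apply: (gauge_sym wx).
  exact: supported_cyclic k0 cH (gauge_twist xw wx ex tJ) supp.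
have oH4 : #|H| = 4%N.
  have [o1|//] := order_square60 oG oH.
  by case/negP: ncH; rewrite (card1_trivg o1) cyclic1.
have main := supported_transport k0 tJ nsJ (ab H n oH) xw wx ex supp.
have lift (hT : finGroupType) (f : gT -> hT) (H' : {group hT}) : #|hT| = 60%N ->
    {morph f : a b / (a * b)%g} -> injective f -> f @: H = H' ->
    exists J0 : {ffun (hT * hT)%type -> k}, lifted_twist_nontriv H' J0 /\ hopf_isomorphic J J0.
  move=> ohT fM fI; apply: main fM _.
  by apply: inj_card_bij fI _; rewrite ohT oG.
have isoE (hT : finGroupType) (f : gT -> hT) : #|hT| = 60%N ->
    {morph f : a b / (a * b)%g} -> injective f -> ([set: gT] \isog [set: hT])%g.
  move=> ohT fM fI; pose fm := Morphism (in2W fM : {in [set: gT] &, {morph f : x y / (x * y)%g}}).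
  apply/isogP; exists fm; first by apply/injmP=> a b _ _; exact: fI.
  by apply/eqP; rewrite eqEcard subsetT cardsT ohT card_injm ?cardsT ?oG //; apply/injmP=> a b _ _; exact: fI.
case: (group60_klein oG Z1 oH4 ncH) => [[f [fM fI fH]]|iD]; [left|right].
  have oA : #|A5T| = 60%N.
    have := card_isog (isog_subg 'Alt_('I_5)%G); rewrite cardsT => <-.
    by apply/eqP; rewrite -(@eqn_pmul2l 2) // card_Alt card_ord.
  split; first exact: isoE fM fI.
  (* [H0] is declared as a set; the same generated set is repackaged as a group for [lift]. *)
  pose H0g : {group A5T} :=
    <<[set subg 'Alt_('I_5)%G perm_12_34; subg 'Alt_('I_5)%G perm_13_24]>>%G.
  refine (lift _ f H0g oA fM fI fH).
split=> //; have [fm injf imf] := isogP iD.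
have oD : #|D3xD5| = 60%N by rewrite -cardsT -(card_isog iD) cardsT.
have fM : {morph fm : a b / (a * b)%g} by move=> a b; rewrite morphM ?inE.
have fI : injective fm by move=> a b; apply: (injmP injf); rewrite inE.
have fH : fm @: H = (fm @* H)%G by rewrite /= morphimEsub ?subsetT.
(* H_1 is taken to be the image of H, so no conjugation onto a prescribed subgroup is needed
   here. *)
have [J1 [l1 i1]] := lift _ fm (fm @* H)%G oD fM fI fH.
exists (fm @* H)%G, J1; split=> //.
apply: klein_isog; first by rewrite /= card_injm ?subsetT.
have V2 := elementary_order4 oH4 ncH.
move=> u /=; rewrite morphimEsub ?subsetT // => /imsetP[h Hh ->].
by rewrite -morphX ?inE // V2 // morph1.
Qed.
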